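(* Suppose that (A1) $\sup_{k,n,t}E\big(X_{kt}-E(X_{kt})\big)^4<\infty$ and (SNR1) $n\,m^{-1}\|\mu_1-\mu_2\|_2^2\to\infty$ as $n\to\infty$. Then $$n\|\mu_1-\mu_2\|_2^2\,(\hat\tau_{n,\mathrm{LSE}}-\tau_n)=O_P(1).$$
   Context: For each $n$ we observe $m=m(n)$ series at $n$ time points, $\{X_{kt}=X_{kt}^{(n)}:1\le k\le m,\ 1\le t\le n\}$ (the dependence on $n$ is suppressed). There is a common change point $\tau_n$ with $0<c^*<\tau_n<1-c^*<1$ for a fixed $c^*>0$. The series are independent over $k$; for each $k$, the variables $\{X_{kt}:t\le n\tau_n\}$ are i.i.d., the variables $\{X_{kt}:t>n\tau_n\}$ are i.i.d., and these two sets are independent. Times $n\tau_n$ and $nb$ are integers, i.e. $\tau_n$ and the candidate points $b$ lie in $\{1/n,2/n,\dots,1\}$. Means: $E(X_{kt})=\mu_{1k}I(t\le n\tau_n)+\mu_{2k}I(t>n\tau_n)$, where $\mu_{ik}=\mu_{ik}(n)$ may depend on $n$ and $\mu_{1k}\ne\mu_{2k}$ for at least one $k$. Put $\mu_i=(\mu_{i1},\dots,\mu_{im})$, and $\|\cdot\|_2$ is the Euclidean norm. Least squares estimator: $\hat\tau_{n,\mathrm{LSE}}=\arg\max_{b\in(c^*,1-c^* )}M_n(b)$, where $$M_n(b)=-\frac1n\sum_{k=1}^m\Big[\sum_{t=1}^{nb}(X_{kt}-\hat\mu_{1k}(b))^2+\sum_{t=nb+1}^{n}(X_{kt}-\hat\mu_{2k}(b))^2\Big],$$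 $\hat\mu_{1k}(b)=\frac1{nb}\sum_{t=1}^{nb}X_{kt}$, $\hat\mu_{2k}(b)=\frac1{n(1-b)}\sum_{t=nb+1}^nX_{kt}$. *)

(* Defs.v *)
From HB Require Import structures.
From mathcomp Require Import all_boot all_order all_algebra finmap.
From mathcomp Require Import all_classical all_reals all_analysis.

Set Implicit Arguments.
Unset Strict Implicit.
Unset Printing Implicit Defensive.

Import Order.TTheory GRing.Theory Num.Theory.
Import numFieldNormedType.Exports.

Local Open Scope classical_set_scope.
Local Open Scope ring_scope.

Definition independent_classes (R : realType) (d : measure_display)
    (T : measurableType d) (P : probability T R) (I : choiceType) (D : set I)
    (F : I -> set (set T)) : Prop :=
  forall (J : {fset I}) (E : I -> set T),
    [set` J] `<=` D ->
    (forall i, i \in J -> F i (E i)) ->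
    P (\bigcap_(i in [set` J]) E i) = (\prod_(i <- J) P (E i))%E.

Definition sigma_rv (R : realType) (d : measure_display) (T : measurableType d)
    (I : Type) (D : set I) (X : I -> T -> R) : set (set T) :=
  <<s \bigcup_(i in D) preimage_set_system setT (X i) measurable >>.

Definition independent_rvs (R : realType) (d : measure_display)
    (T : measurableType d) (P : probability T R) (I : choiceType) (D : set I)
    (X : I -> T -> R) : Prop :=
  independent_classes P D (fun i => sigma_rv [set i] X).

Definition independent_pair (R : realType) (d : measure_display)
    (T : measurableType d) (P : probability T R) (F G : set (set T)) : Prop :=
  forall A B, F A -> G B -> P (A `&` B) = (P A * P B)%E.

Definition identically_distributed (R : realType) (d : measure_display)
    (T : measurableType d) (P : probability T R) (I : Type) (D : set I)
    (X : I -> {RV P >-> R}) : Prop :=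
  forall i j, D i -> D j ->
  forall B : set R, measurable B -> distribution P (X i) B = distribution P (X j) B.

Definition iid (R : realType) (d : measure_display)
    (T : measurableType d) (P : probability T R) (I : choiceType) (D : set I)
    (X : I -> {RV P >-> R}) : Prop :=
  independent_rvs P D (fun i => X i : T -> R) /\ identically_distributed D X.

Definition bounded_in_probability (R : realType) (d : nat -> measure_display)
    (T : forall n, measurableType (d n)) (P : forall n, probability (T n) R)
    (Z : forall n, T n -> R) : Prop :=
  forall eps : R, 0 < eps ->
    exists K : R, \forall n \near \oo, (P n [set w | (K < `|Z n w|)%R] <= eps%:E)%E.

Definition norm2 (R : realType) (p : nat) (v : 'rV[R]_p) : R :=
  Num.sqrt (\sum_(k < p) (v 0 k) ^+ 2).

Definition times (n : nat) : set nat := [set t | (1 <= t <= n)%N].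

Definition pre_times (R : realType) (n : nat) (b : R) : set nat :=
  [set t | times n t /\ t%:R <= n%:R * b].

Definition post_times (R : realType) (n : nat) (b : R) : set nat :=
  [set t | times n t /\ n%:R * b < t%:R].

Definition time_grid (R : realType) (n : nat) : set R :=
  [set b | exists2 j : nat, (1 <= j <= n)%N & b = j%:R / n%:R].

(* Only used for [b] in [time_grid n], where [n * b] is a natural number and
   the truncation is exact. *)
Definition split_time (R : realType) (n : nat) (b : R) : nat :=
  Num.truncn (n%:R * b).

Definition muhat1 (R : realType) (n : nat) (x : nat -> R) (b : R) : R :=
  (n%:R * b)^-1 * \sum_(1 <= t < (split_time n b).+1) x t.

Definition muhat2 (R : realType) (n : nat) (x : nat -> R) (b : R) : R :=
  (n%:R * (1 - b))^-1 * \sum_((split_time n b).+1 <= t < n.+1) x t.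

Definition lse_criterion (R : realType) (n m : nat) (x : 'I_m -> nat -> R)
    (b : R) : R :=
  - (n%:R^-1 * \sum_(k < m)
       (\sum_(1 <= t < (split_time n b).+1) (x k t - muhat1 n (x k) b) ^+ 2
        + \sum_((split_time n b).+1 <= t < n.+1)
            (x k t - muhat2 n (x k) b) ^+ 2)).

Definition lse_candidates (R : realType) (n : nat) (c : R) : set R :=
  time_grid n `&` [set b | c < b < 1 - c].

(* The maximizer need not be unique; any choice is allowed. *)
Definition is_lse (R : realType) (n m : nat) (c : R) (x : 'I_m -> nat -> R)
    (b : R) : Prop :=
  lse_candidates n c b /\
  forall b', lse_candidates n c b' -> lse_criterion n x b' <= lse_criterion n x b.

(* Main.v *)
Require Import Defs.
From HB Require Import structures.
From mathcomp Require Import all_boot all_order all_algebra finmap.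
From mathcomp Require Import all_classical all_reals all_analysis.
From mathcomp Require Import measurable_realfun.
From mathcomp Require Import ring lra zify.

Set Implicit Arguments.
Unset Strict Implicit.
Unset Printing Implicit Defensive.

Import Order.TTheory GRing.Theory Num.Theory.
Import numFieldNormedType.Exports.

Local Open Scope classical_set_scope.
Local Open Scope ring_scope.

(** Let [D] be the squared norm of the jump and [s] the number of observations
    before the change.  By symmetry in time consider only a candidate at
    distance [h] from [s] on a side of length [p], the opposite side having
    length [q].  Let [A], [Q], [B] be the vectors (over the [m] series) of the
    sums of the centred observations between the two splits, over the whole
    side of length [p], and over the opposite side.  Comparing residual sums of
    squares gives the exact identity [split_gain]: moving the split away from
    the change costs, with [delta] the jump,

      h (q / (q + h) |delta + A / h - B / q|^2
         - (p - h) / p |(Q - A) / (p - h) - A / h|^2).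

    Since [p - h] and [q] are at least [c n], the signal part of the bracket is
    at least a constant times [D], and the cost is positive as soon as the
    noise obeys, with a small constant in front of each right-hand side,

      |A|^2, |A.B|, |A.Q| <= h n D,  |A.delta| <= h D,  |B|^2, |Q|^2 <= n^2 D

    ([gain_positive]).  So it suffices that these hold simultaneously for all
    [h > K / D] outside an event of probability O(1/K) + O(m / (n D))
    ([one_sided]).  The last two bounds are Markov's inequality.  For the
    others the distances are grouped in dyadic blocks [2^i <= h <= 2^(i+1)],
    and a maximal inequality of Doob type is applied in each block:

    - if [b] is independent of the increments of [A], then [A.b] is a
      martingale in [h] of variance O(h E|b|^2); this covers [b = B] and
      [b = delta], and also [A.Q] after writing [Q] as the sum over the block
      plus an independent rest, the product with the former being controlled
      by |A|^2;
    - |A|^2 is a submartingale with mean O(h m), negligible against [h n D]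
      because m / (n D) tends to 0, and with variance O(h^2 m).  Centring is
      essential: Markov's inequality for |A|^2 itself would give m / (n D) for
      every block, which does not sum.  This variance is where fourth moments
      and the independence of the series enter.

    Each block then contributes O(1 / (2^i D)) (for |A|^2 because [2^i <= n]),
    and the blocks reaching beyond [K / D] sum geometrically to O(1/K).

    All moment computations rest on one consequence of independence: a centred
    observation is orthogonal to every integrable function of the other ones
    ([noise_orth]).  It follows from the product formula on rectangles
    ([rectangle_prob]), a pi-lambda argument ([indep_rest]) and Fubini's
    theorem ([Ex_mul_indep]). *)

(** * Real-valued expectation and moment classes *)

Lemma measurable_gt (R : realType) (d : measure_display)
    (T : measurableType d) (f : T -> R) (a : R) :
  measurable_fun setT f -> measurable [set w | a < f w].
Proof.
move=> mf; have := mf measurableT `]a, +oo[%classic (measurable_itv _).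
by rewrite setTI preimage_itvoy.
Qed.

Section expectation.
Context (R : realType) (d : measure_display) (T : measurableType d).
Context (P : probability T R).
Implicit Types f g : T -> R.

Definition Ex f : R := \int[P]_w f w.
Definition Pr (A : set T) : R := fine (P A).

Definition L1 f := P.-integrable setT (EFin \o f).
Definition L2 f := measurable_fun setT f /\ L1 (fun w => f w ^+ 2).
Definition L4 f := measurable_fun setT f /\ L1 (fun w => f w ^+ 4).

Lemma L1_measurable f : L1 f -> measurable_fun setT f.
Proof. by move=> /integrableP[/measurable_EFinP]. Qed.

Lemma L1_dom f g : measurable_fun setT f -> L1 g ->
  (forall w, `|f w| <= g w) -> L1 f.
Proof.
move=> mf ig fg; apply: le_integrable ig => //; first exact/measurable_EFinP.
move=> w _ /=; rewrite lee_fin (le_trans (fg w))//.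
by rewrite ler_norm.
Qed.

Lemma L1D f g : L1 f -> L1 g -> L1 (fun w => f w + g w).
Proof. by move=> f1 g1; exact: (integrableD measurableT f1 g1). Qed.

Lemma L1Z a f : L1 f -> L1 (fun w => a * f w).
Proof. by move=> f1; exact: (integrableZl measurableT a f1). Qed.

Lemma L1B f g : L1 f -> L1 g -> L1 (fun w => f w - g w).
Proof. by move=> f1 g1; exact: (integrableB measurableT f1 g1). Qed.

Lemma L1_cst a : L1 (fun=> a).
Proof. exact: finite_measure_integrable_cst. Qed.

Lemma L1_sum (I : Type) (r : seq I) (F : I -> T -> R) :
  (forall i, L1 (F i)) -> L1 (fun w => \sum_(i <- r) F i w).
Proof.
move=> hF; elim: r => [|i r IH].
  by under eq_fun do rewrite big_nil; exact: L1_cst.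
by under eq_fun do rewrite big_cons; exact: L1D.
Qed.

Lemma L2_mul f g : L2 f -> L2 g -> L1 (fun w => f w * g w).
Proof.
move=> [mf f2] [mg g2]; apply: (L1_dom _ (L1D f2 g2)).
  exact: measurable_funM.
move=> w; rewrite normrM -(real_normK (num_real (f w))).
by rewrite -(real_normK (num_real (g w))); nra.
Qed.

Lemma L2D f g : L2 f -> L2 g -> L2 (fun w => f w + g w).
Proof.
move=> f2 g2; split; first exact: measurable_funD f2.1 g2.1.
apply: (L1_dom _ (L1D (L1Z 2 f2.2) (L1Z 2 g2.2))); last first.
  by move=> w; rewrite ger0_norm ?sqr_ge0//; have := sqr_ge0 (f w - g w); nra.
by apply: measurable_funX; exact: measurable_funD f2.1 g2.1.
Qed.

Lemma L2Z a f : L2 f -> L2 (fun w => a * f w).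
Proof.
move=> f2; split; first exact: measurable_funM f2.1.
by under eq_fun do rewrite exprMn; exact: L1Z f2.2.
Qed.

Lemma L2_cst a : L2 (fun=> a).
Proof. by split=> //; exact: L1_cst. Qed.

Lemma L2_sum (I : Type) (r : seq I) (F : I -> T -> R) :
  (forall i, L2 (F i)) -> L2 (fun w => \sum_(i <- r) F i w).
Proof.
move=> hF; elim: r => [|i r IH].
  by under eq_fun do rewrite big_nil; exact: L2_cst.
by under eq_fun do rewrite big_cons; exact: L2D.
Qed.

Lemma L2_L1 f : L2 f -> L1 f.
Proof.
move=> f2; have := L2_mul f2 (L2_cst 1).
by under eq_fun do rewrite mulr1.
Qed.

Lemma L2B f g : L2 f -> L2 g -> L2 (fun w => f w - g w).
Proof.
move=> f2 g2; have := L2D f2 (L2Z (-1) g2).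
by under eq_fun do rewrite mulN1r.
Qed.

Lemma L4D f g : L4 f -> L4 g -> L4 (fun w => f w + g w).
Proof.
move=> f4 g4; split; first exact: measurable_funD f4.1 g4.1.
apply: (L1_dom _ (L1D (L1Z 8 f4.2) (L1Z 8 g4.2))); last first.
  move=> w; rewrite ger0_norm ?exprn_even_ge0//.
  have h1 : (f w + g w) ^+ 2 <= 2 * (f w ^+ 2 + g w ^+ 2).
    by have := sqr_ge0 (f w - g w); nra.
  have h2 : (f w ^+ 2 + g w ^+ 2) ^+ 2 <= 2 * (f w ^+ 4 + g w ^+ 4).
    by rewrite -subr_ge0 [leRHS](_ : _ = (f w ^+ 2 - g w ^+ 2) ^+ 2) ?sqr_ge0//; ring.
  have -> : (f w + g w) ^+ 4 = ((f w + g w) ^+ 2) ^+ 2 by rewrite -exprM.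
  apply: (@le_trans _ _ ((2 * (f w ^+ 2 + g w ^+ 2)) ^+ 2)).
    by rewrite lerXn2r// nnegrE ?sqr_ge0// mulr_ge0// addr_ge0// sqr_ge0.
  by rewrite exprMn; lra.
by apply: measurable_funX; exact: measurable_funD f4.1 g4.1.
Qed.

Lemma L4_cst a : L4 (fun=> a).
Proof. by split=> //; exact: L1_cst. Qed.

Lemma L4_sum (I : Type) (r : seq I) (F : I -> T -> R) :
  (forall i, L4 (F i)) -> L4 (fun w => \sum_(i <- r) F i w).
Proof.
move=> hF; elim: r => [|i r IH].
  by under eq_fun do rewrite big_nil; exact: L4_cst.
by under eq_fun do rewrite big_cons; exact: L4D.
Qed.

Lemma L4_mul f g : L4 f -> L4 g -> L2 (fun w => f w * g w).
Proof.
move=> [mf f4] [mg g4]; split; first exact: measurable_funM.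
apply: (L1_dom _ (L1D f4 g4)).
  by apply: measurable_funX; exact: measurable_funM.
move=> w; rewrite ger0_norm ?sqr_ge0// exprMn.
have := sqr_ge0 (f w ^+ 2 - g w ^+ 2).
have := sqr_ge0 (f w ^+ 2 + g w ^+ 2).
nra.
Qed.

Lemma L4_L2 f : L4 f -> L2 f.
Proof.
move=> f4; have := L4_mul f4 (L4_cst 1).
by under eq_fun do rewrite mulr1.
Qed.

Lemma L4_sqr f : L4 f -> L2 (fun w => f w ^+ 2).
Proof. by move=> f4; have := L4_mul f4 f4. Qed.

Lemma measurable_indicT (A : set T) : measurable A -> measurable_fun setT (\1_A : T -> R).
Proof. by move=> mA; exact: measurable_indic. Qed.

Lemma indic_01 (A : set T) w : 0 <= (\1_A w : R) <= 1.
Proof. by rewrite indicE; case: (_ \in _) => /=; rewrite ?lexx ?ler01. Qed.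

Lemma L1_indic (A : set T) f : measurable A -> L1 f -> L1 (fun w => \1_A w * f w).
Proof.
move=> mA f1; have f1' : L1 (fun w => `|f w|).
  have := integrable_abse f1; congr (_.-integrable _ _).
apply: (L1_dom _ f1'); first exact: measurable_funM (measurable_indicT mA) (L1_measurable f1).
move=> w; have /andP[h0 h1] := indic_01 A w.
by rewrite normrM ger0_norm// ler_piMl.
Qed.

Lemma ExD f g : L1 f -> L1 g -> Ex (fun w => f w + g w) = Ex f + Ex g.
Proof. by move=> f1 g1; exact: RintegralD. Qed.

Lemma ExB f g : L1 f -> L1 g -> Ex (fun w => f w - g w) = Ex f - Ex g.
Proof. by move=> f1 g1; exact: RintegralB. Qed.

Lemma ExZ a f : L1 f -> Ex (fun w => a * f w) = a * Ex f.
Proof. by move=> f1; exact: RintegralZl. Qed.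

Lemma Ex_cst a : Ex (fun=> a) = a.
Proof. by rewrite /Ex Rintegral_cst// [X in fine X](probability_setT P) mulr1. Qed.

Lemma Ex_sum (I : Type) (r : seq I) (F : I -> T -> R) :
  (forall i, L1 (F i)) -> Ex (fun w => \sum_(i <- r) F i w) = \sum_(i <- r) Ex (F i).
Proof.
move=> hF; elim: r => [|i r IH].
  by under eq_fun do rewrite big_nil; rewrite Ex_cst big_nil.
under eq_fun do rewrite big_cons.
by rewrite ExD// ?IH ?big_cons//; exact: L1_sum.
Qed.

Lemma Ex_ge0 f : (forall w, 0 <= f w) -> 0 <= Ex f.
Proof. by move=> f0; exact: Rintegral_ge0. Qed.

Lemma Ex_le f g : L1 f -> L1 g -> (forall w, f w <= g w) -> Ex f <= Ex g.
Proof. by move=> f1 g1 fg; exact: le_Rintegral. Qed.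

Lemma Ex_indic (A : set T) : measurable A -> Ex (fun w => \1_A w) = Pr A.
Proof.
move=> mA; rewrite /Ex /Pr /Rintegral.
by rewrite integral_indic// setIT.
Qed.

Lemma PrE (A : set T) : measurable A -> P A = (Pr A)%:E.
Proof. by move=> mA; rewrite /Pr fineK// fin_num_measure. Qed.

Lemma Pr_ge0 (A : set T) : 0 <= Pr A.
Proof. exact: fine_ge0. Qed.

Lemma Pr_le (A B : set T) : measurable A -> measurable B -> A `<=` B -> Pr A <= Pr B.
Proof.
move=> mA mB AB; rewrite -lee_fin -!PrE//.
by apply: le_measure => //; rewrite inE.
Qed.

Lemma PrU (A B : set T) : measurable A -> measurable B -> Pr (A `|` B) <= Pr A + Pr B.
Proof.
move=> mA mB; rewrite -lee_fin EFinD -!PrE//; last exact: measurableU.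
exact: measureU2.
Qed.

Lemma Pr_bigcup (F : nat -> set T) n : (forall i, measurable (F i)) ->
  Pr (\big[setU/set0]_(i < n) F i) <= \sum_(i < n) Pr (F i).
Proof.
move=> mF; elim: n => [|n IH].
  by rewrite !big_ord0 /Pr measure0.
rewrite !big_ord_recr/=; apply: (le_trans (PrU _ _)) => //.
  exact: bigsetU_measurable.
by rewrite lerD2r.
Qed.

Lemma markov_Pr f a : 0 < a -> L1 f -> (forall w, 0 <= f w) ->
  Pr [set w | a < f w] <= Ex f / a.
Proof.
move=> a0 f1 f0; rewrite ler_pdivlMr// mulrC.
have mA : measurable [set w | a < f w].
  exact/measurable_gt/L1_measurable.
rewrite -Ex_indic// -ExZ; last exact: integrable_indic.
apply: Ex_le => //; first by apply: L1Z; exact: integrable_indic.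
move=> w; rewrite indicE; case: (boolP (w \in _)) => /=.
  by rewrite inE/= => /ltW; rewrite mulr1.
by rewrite mulr0.
Qed.

End expectation.

(** * Independence of one observation from all the others *)

Section product_expectation.
Context (R : realType) (d : measure_display) (T : measurableType d).
Context (P : probability T R).

(** The joint law of [f] and [g] agrees with the product of the marginal laws on
    rectangles, hence everywhere; the claim is then Fubini's theorem. *)
Lemma Ex_mul_indep (f g : T -> R) : L1 P f -> L1 P g ->
  (forall A B : set R, measurable A -> measurable B ->
    P (f @^-1` A `&` g @^-1` B) = P (f @^-1` A) * P (g @^-1` B))%E ->
  L1 P (fun w => f w * g w) /\ Ex P (fun w => f w * g w) = Ex P f * Ex P g.
Proof.
move=> f1 g1 fg.
have mf := L1_measurable f1; have mg := L1_measurable g1.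
pose F : {mfun T >-> R} := HB.pack f (isMeasurableFun.Build _ _ _ _ f mf).
pose G : {mfun T >-> R} := HB.pack g (isMeasurableFun.Build _ _ _ _ g mg).
pose h w := (f w, g w).
have mh : measurable_fun setT h by exact: measurable_fun_pair.
pose H : {mfun T >-> (R * R)%type} :=
  HB.pack h (isMeasurableFun.Build _ _ _ _ h mh).
pose m1 := distribution P F; pose m2 := distribution P G.
pose m' := distribution P H.
have mE X : measurable X -> (m1 \x m2)%E X = m' X.
  by apply: product_measure_unique => A B mA mB; rewrite -fg.
pose k (z : R * R) := (z.1 * z.2)%:E.
have mk : measurable_fun setT k.
  by apply/measurable_EFinP; apply: measurable_funM;
    [exact: measurable_fst|exact: measurable_snd].
have mabs : measurable_fun setT (fun y : R => `|y%:E|%E).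
  by apply: measurableT_comp => //; exact: EFin_measurable.
have absf : (\int[m1]_x `|x%:E| = \int[P]_w `|(f w)%:E|)%E.
  by rewrite ge0_integral_distribution.
have absg : (\int[m2]_x `|x%:E| = \int[P]_w `|(g w)%:E|)%E.
  by rewrite ge0_integral_distribution.
have kE : (\int[m1 \x m2]_z `|k z| = \int[m']_z `|k z|)%E.
  by apply: eq_measure_integral => A mA _; exact: mE.
have /integrableP[_ fy] := f1.
have /integrableP[_ gy] := g1.
have ik : (m1 \x m2)%E.-integrable setT k.
  apply/(integrable12ltyP m1 m2 mk).
  under eq_integral do under eq_integral do rewrite /k /= normrM EFinM.
  under eq_integral do rewrite ge0_integralZl//= -/m2 [X in (_ * X)%E]absg.
  rewrite ge0_integralZr//=; last exact: integral_ge0.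
  rewrite -/m1 [X in (X * _)%E]absf.
  apply: lte_mul_pinfty => //; first exact: integral_ge0.
  by rewrite ge0_fin_numE//; exact: integral_ge0.
have ifg : L1 P (fun w => f w * g w).
  apply/integrableP; split.
    by apply/measurable_EFinP; exact: measurable_funM.
  have /integrableP[_] := ik; rewrite kE => ky.
  rewrite (_ : \int[_]_(x in _) _ = \int[m']_z `|k z|)%E//.
  by rewrite ge0_integral_distribution//; exact: measurableT_comp.
split=> //; rewrite /Ex /Rintegral.
have -> : (\int[P]_w (f w * g w)%:E = \int[m']_z k z)%E.
  by rewrite integral_distribution.
have -> : (\int[m']_z k z = \int[m1 \x m2]_z k z)%E.
  by apply: eq_measure_integral => A mA _; rewrite [RHS]mE.
rewrite -(integral12_prod_meas1 ik) /fubini_F /k /=.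
have i2 : m2.-integrable setT (EFin : R -> \bar R).
  by apply/integrableP; split => //; rewrite absg.
have i1 : m1.-integrable setT (EFin : R -> \bar R).
  by apply/integrableP; split => //; rewrite absf.
have e2 : (\int[m2]_y y%:E = \int[P]_w (g w)%:E)%E.
  by rewrite integral_distribution.
have e1 : (\int[m1]_y y%:E = \int[P]_w (f w)%:E)%E.
  by rewrite integral_distribution.
under eq_integral => x _.
  under eq_integral do rewrite EFinM.
  rewrite integralZl//= e2; over.
have gfin : (\int[P]_w (g w)%:E)%E \is a fin_num by exact: integrable_fin_num.
have ffin : (\int[P]_w (f w)%:E)%E \is a fin_num by exact: integrable_fin_num.
rewrite -(fineK gfin) integralZr// e1 -fineM//.
Qed.

End product_expectation.

Section noise.
Context (R : realType) (d : measure_display) (T : measurableType d).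
Context (P : probability T R) (I : choiceType) (e : I -> T -> R).

(** [adapted D f] says that [f] depends on the variables [e i], [i \in D], only:
    it is measurability for the sigma-algebra that they generate.  Encoding it
    as measurability on a retyped copy of [T] makes the closure lemmas on
    measurable functions available. *)
Definition generators (D : set I) : set (set T) :=
  \bigcup_(i in D) preimage_set_system setT (e i) measurable.

Definition adapted (D : set I) (f : T -> R) : Prop :=
  measurable_fun [set: g_sigma_algebraType (generators D)]
    (f : g_sigma_algebraType (generators D) -> R).

Lemma adapted_e D i : D i -> adapted D (e i).
Proof.
move=> Di _ B mB; rewrite setTI; apply: sub_sigma_algebra.
by exists i => //; exists B => //; rewrite setTI.
Qed.

Lemma adapted_cst D a : adapted D (fun=> a).
Proof. exact: measurable_cst. Qed.

Lemma adaptedD D f g : adapted D f -> adapted D g -> adapted D (fun w => f w + g w).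
Proof. by move=> fD gD; exact: (measurable_funD fD gD). Qed.

Lemma adaptedM D f g : adapted D f -> adapted D g -> adapted D (fun w => f w * g w).
Proof. by move=> fD gD; exact: (measurable_funM fD gD). Qed.

Lemma adaptedX D f n : adapted D f -> adapted D (fun w => f w ^+ n).
Proof. by move=> fD; exact: (measurable_funX _ fD). Qed.

Lemma adapted_sum D (J : eqType) (r : seq J) (F : J -> T -> R) :
  (forall i, i \in r -> adapted D (F i)) -> adapted D (fun w => \sum_(i <- r) F i w).
Proof.
elim: r => [|i r IH] hF.
  by under eq_fun do rewrite big_nil; exact: adapted_cst.
under eq_fun do rewrite big_cons; apply: adaptedD.
  by apply: hF; rewrite mem_head.
by apply: IH => j jr; apply: hF; rewrite in_cons jr orbT.
Qed.

Lemma adapted_bigcup_indic D n (F : nat -> T -> R) a :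
  (forall i, (i < n)%N -> adapted D (F i)) ->
  adapted D (\1_(\big[setU/set0]_(i < n) [set w | a < F i w])).
Proof.
move=> hF; apply: measurable_indic; apply: bigsetU_measurable => i _.
apply: (@measurable_gt _ _ (g_sigma_algebraType (generators D))).
exact: hF.
Qed.

(** Mutual independence is recorded as the independence of each variable from
    the sigma-algebra of all the others, which is the form in which it is used
    throughout. *)
Record white_noise (C : R) : Prop := WhiteNoise {
  noise_ge1 : 1 <= C ;
  noise_L4 : forall i, L4 P (e i) ;
  noise_mean : forall i, Ex P (e i) = 0 ;
  noise_moment4 : forall i, Ex P (fun w => e i w ^+ 4) <= C ;
  noise_indep : forall i B A, measurable B -> <<s generators [set~ i] >> A ->
    (P (A `&` e i @^-1` B) = P A * P (e i @^-1` B))%E }.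

Context (C : R) (eC : white_noise C).

Lemma noise_C0 : 0 <= C.
Proof. exact: le_trans (noise_ge1 eC). Qed.

(** From [2 y <= y^2 + 1] with [y] the square of the variable, and [1 <= C]. *)
Lemma noise_moment2 i : Ex P (fun w => e i w ^+ 2) <= C.
Proof.
have h4 := noise_L4 eC i; have h2 := L4_sqr h4.
have := @Ex_ge0 _ _ _ P (fun w => (e i w ^+ 2 - 1) ^+ 2) (fun w => sqr_ge0 _).
have -> : (fun w => (e i w ^+ 2 - 1) ^+ 2) =
    (fun w => (e i w ^+ 4 - 2 * e i w ^+ 2) + 1).
  by apply/funext => w; ring.
have i2 := L1Z 2 (L2_L1 h2).
rewrite ExD ?ExB ?ExZ ?Ex_cst//; [|exact: L2_L1|exact: h4.2|exact: L1B h4.2 i2|exact: L1_cst].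
have := noise_moment4 eC i; have := noise_ge1 eC; lra.
Qed.

(** The martingale difference property, in a form that does not depend on any
    ordering of the variables: it serves sums taken in either direction of
    time, and products of variables of different series. *)
Lemma noise_orth i f : adapted [set~ i] f -> L1 P f ->
  L1 P (fun w => f w * e i w) /\ Ex P (fun w => f w * e i w) = 0.
Proof.
move=> fi f1; have [] := @Ex_mul_indep _ _ _ P f (e i) f1 (L2_L1 (L4_L2 (noise_L4 eC i))).
  move=> A B mA mB; apply: (noise_indep eC mB).
  by have := fi measurableT A mA; rewrite setTI.
by move=> ? ->; rewrite (noise_mean eC) mulr0.
Qed.

Lemma noise_sqr i f : adapted [set~ i] f -> L1 P f ->
  L1 P (fun w => f w * e i w ^+ 2) /\
  Ex P (fun w => f w * e i w ^+ 2) = Ex P f * Ex P (fun w => e i w ^+ 2).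
Proof.
move=> fi f1; apply: Ex_mul_indep => //; first exact: (L4_L2 (noise_L4 eC i)).2.
move=> A B mA mB.
have msq : measurable_fun setT (fun x : R => x ^+ 2) by exact: measurable_funX.
have := msq measurableT B mB; rewrite setTI => mB'.
apply: (noise_indep eC (i := i) (B := (fun x : R => x ^+ 2) @^-1` B)) => //.
by have := fi measurableT A mA; rewrite setTI.
Qed.

End noise.

(** * Maximal inequalities *)

Section doob.
Context (R : realType) (d : measure_display) (T : measurableType d).
Context (P : probability T R).

Definition exceeds (lam : R) (G : nat -> T -> R) (h : nat) : set T :=
  \big[setU/set0]_(i < h.+1) [set w | lam < G i w].

Lemma exceedsP lam G h w :
  exceeds lam G h w <-> exists2 i, (i <= h)%N & lam < G i w.
Proof.
rewrite /exceeds -(bigcup_mkord h.+1 (fun i => [set w | lam < G i w])).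
by split=> [[i /= ih Gi]|[i ih Gi]]; exists i.
Qed.

Lemma measurable_exceeds lam G h : (forall i, measurable_fun setT (G i)) ->
  measurable (exceeds lam G h).
Proof. by move=> mG; apply: bigsetU_measurable => i _; exact: measurable_gt. Qed.

(** Doob's inequality by induction on the horizon.  When one step is added, the
    crossing event grows by points where the new value itself exceeds [lam],
    and on the old part the submartingale step allows to replace [G h] by
    [G h.+1].  The step is required against the crossing events only, which
    takes the place of a filtration and conditional expectations. *)
Lemma doob lam (G : nat -> T -> R) (H : nat) : (forall h, L1 P (G h)) ->
  (forall h, (h < H)%N ->
    0 <= Ex P (fun w => \1_(exceeds lam G h) w * (G h.+1 w - G h w))) ->
  lam * Pr P (exceeds lam G H) <= Ex P (fun w => \1_(exceeds lam G H) w * G H w).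
Proof.
move=> G1 step.
have mF h : measurable (exceeds lam G h).
  by apply: measurable_exceeds => i; exact: L1_measurable.
have i1 h : L1 P (\1_(exceeds lam G h)) by exact: integrable_indic.
have iG h h' : L1 P (fun w => \1_(exceeds lam G h) w * G h' w) by exact: L1_indic.
elim: H step => [_|h IH step].
  rewrite -Ex_indic// -ExZ//; apply: Ex_le => //; first exact: L1Z.
  move=> w; rewrite indicE mulrC; case: (boolP (w \in _)) => /=.
    rewrite inE => /exceedsP[i]; rewrite leqn0 => /eqP-> /ltW.
    by rewrite !mul1r.
  by rewrite !mul0r.
have {}IH := IH (fun h' hh' => step h' (ltnW hh')).
have := step h (ltnSn h).
under eq_fun do rewrite mulrBr.
rewrite ExB// => {}step.
rewrite -Ex_indic// -ExZ//.
have : Ex P (fun w => lam * \1_(exceeds lam G h.+1) w) <=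
  Ex P (fun w => lam * \1_(exceeds lam G h) w +
     (\1_(exceeds lam G h.+1) w * G h.+1 w - \1_(exceeds lam G h) w * G h.+1 w)).
  apply: Ex_le => //; first exact: L1Z.
    by apply: L1D; [exact: L1Z|exact: L1B].
  move=> w; rewrite !indicE.
  case: (boolP (w \in exceeds lam G h)) => /=.
    rewrite inE => /exceedsP[i ih Gi].
    have -> : w \in exceeds lam G h.+1.
      by rewrite inE; apply/exceedsP; exists i => //; exact: leqW.
    by rewrite /= subrr addr0.
  move=> /negP; rewrite inE => nF.
  rewrite mulr0 add0r mul0r subr0; case: (boolP (w \in _)) => /=.
    rewrite inE => /exceedsP[i]; rewrite leq_eqVlt => /predU1P[-> /ltW|].
      by rewrite mulr1 mul1r.
    by rewrite ltnS => ih Gi; exfalso; apply: nF; apply/exceedsP; exists i.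
  by rewrite mulr0 mul0r.
rewrite ExD ?ExB ?ExZ//; [|exact: L1Z|exact: L1B].
rewrite !Ex_indic//; lra.
Qed.

Lemma doob_ge0 lam (G : nat -> T -> R) (H : nat) : (forall h, L1 P (G h)) ->
  (forall w, 0 <= G H w) ->
  (forall h, (h < H)%N ->
    0 <= Ex P (fun w => \1_(exceeds lam G h) w * (G h.+1 w - G h w))) ->
  lam * Pr P (exceeds lam G H) <= Ex P (G H).
Proof.
move=> G1 G0 step; apply: (le_trans (doob G1 step)).
have mF : measurable (exceeds lam G H).
  by apply: measurable_exceeds => i; exact: L1_measurable.
apply: Ex_le => //; first exact: L1_indic.
by move=> w; rewrite ler_piMl//; have /andP[] := indic_01 R (exceeds lam G H) w.
Qed.

(** The parabola [(z - v)^2] lies above its tangent at [lam]; integrating this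
    over the crossing event reduces the claim to [doob].  It plays the part of
    Doob's inequality for the submartingale [(G - v)_+^2]. *)
Lemma doob_var lam v (G : nat -> T -> R) (H : nat) : (forall h, L1 P (G h)) ->
  L2 P (G H) -> v <= lam ->
  (forall h, (h < H)%N ->
    0 <= Ex P (fun w => \1_(exceeds lam G h) w * (G h.+1 w - G h w))) ->
  (lam - v) ^+ 2 * Pr P (exceeds lam G H) <= Ex P (fun w => (G H w - v) ^+ 2).
Proof.
move=> G1 G2 vlam step; have := doob G1 step.
have mF : measurable (exceeds lam G H).
  by apply: measurable_exceeds => i; exact: L1_measurable.
have i1 : L1 P (\1_(exceeds lam G H)) by exact: integrable_indic.
have iG : L1 P (fun w => \1_(exceeds lam G H) w * G H w) by exact: L1_indic.
set a := lam - v.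
have : Ex P (fun w => 2 * a * (\1_(exceeds lam G H) w * G H w)
    - (2 * a * v + a ^+ 2) * \1_(exceeds lam G H) w) <= Ex P (fun w => (G H w - v) ^+ 2).
  apply: Ex_le; first by apply: L1B; exact: L1Z.
    exact: (L2B G2 (L2_cst P v)).2.
  move=> w; rewrite indicE; case: (_ \in _); rewrite /=.
    by rewrite mul1r mulr1; have := sqr_ge0 (G H w - v - a); lra.
  by rewrite mul0r !mulr0 subrr sqr_ge0.
rewrite ExB; [|exact: L1Z|exact: L1Z]; rewrite !ExZ// Ex_indic// => h1 h2.
have a0 : 0 <= 2 * a by rewrite mulr_ge0// subr_ge0.
apply: le_trans h1.
have := ler_wpM2l a0 h2; rewrite /a; lra.
Qed.

Lemma Ex_sqr_sum (J : finType) (x : J -> T -> R) : (forall i, L2 P (x i)) ->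
  (forall i j, i != j -> Ex P (fun w => x i w * x j w) = 0) ->
  Ex P (fun w => (\sum_i x i w) ^+ 2) = \sum_i Ex P (fun w => x i w ^+ 2).
Proof.
move=> x2 xo.
under eq_fun => w do [rewrite expr2 mulr_suml; under eq_bigr do rewrite mulr_sumr].
rewrite Ex_sum => [|i]; last by apply: L1_sum => j; exact: L2_mul.
apply: eq_bigr => i _; rewrite Ex_sum => [|j]; last exact: L2_mul.
rewrite (bigD1 i)//= big1 ?addr0// => j ji.
by rewrite xo// eq_sym.
Qed.

End doob.

Section noise_maximal.
Context (R : realType) (d : measure_display) (T : measurableType d).
Context (P : probability T R) (m : nat).
Context (e : 'I_m * (bool * nat) -> T -> R) (C : R) (eC : white_noise P e C).

(** An index [(k, (s, i))] stands for series [k] at distance [i] from the change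
    point, on the side [s]; [true] is the side on which the candidate split
    lies. *)
Definition nsum (s : bool) (k : 'I_m) (h : nat) (w : T) : R :=
  \sum_(i < h) e (k, (s, i : nat)) w.

Definition nsq (s : bool) (h : nat) (w : T) : R := \sum_k nsum s k h w ^+ 2.

Lemma nsumS s k h w : nsum s k h.+1 w = nsum s k h w + e (k, (s, h)) w.
Proof. by rewrite /nsum big_ord_recr. Qed.

Lemma nsum_L4 s k h : L4 P (nsum s k h).
Proof. by apply: L4_sum => i; exact: noise_L4 eC _. Qed.

Lemma nsum_L2 s k h : L2 P (nsum s k h).
Proof. exact/L4_L2/nsum_L4. Qed.

Lemma nsq_L2 s h : L2 P (nsq s h).
Proof. by apply: L2_sum => k; exact/L4_sqr/nsum_L4. Qed.

Lemma nsum_adapted s k h D : (forall i, (i < h)%N -> D (k, (s, i))) ->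
  adapted e D (nsum s k h).
Proof. by move=> hD; apply: adapted_sum => i _; apply: adapted_e; exact: hD. Qed.

Lemma nsq_adapted s h D : (forall k i, (i < h)%N -> D (k, (s, i))) ->
  adapted e D (nsq s h).
Proof.
move=> hD; apply: adapted_sum => k _; apply: adaptedX; apply: nsum_adapted.
exact: hD.
Qed.

Lemma exceeds_indic_adapted lam (G : nat -> T -> R) h D :
  (forall i, (i <= h)%N -> adapted e D (G i)) ->
  adapted e D (\1_(exceeds lam G h)).
Proof. by move=> hG; apply: adapted_bigcup_indic => i; rewrite ltnS; exact: hG. Qed.

Lemma L1_exceeds lam (G : nat -> T -> R) h f : (forall i, measurable_fun setT (G i)) ->
  L1 P f -> L1 P (fun w => \1_(exceeds lam G h) w * f w).
Proof. by move=> mG f1; apply: L1_indic => //; exact: measurable_exceeds. Qed.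

Lemma Ex_noise_sum_sqr (J : finType) (phi : J -> 'I_m * (bool * nat)) :
  injective phi -> Ex P (fun w => (\sum_j e (phi j) w) ^+ 2) <= C * #|J|%:R.
Proof.
move=> phi_inj; rewrite Ex_sqr_sum.
- rewrite mulr_natr -sumr_const.
  by apply: ler_sum => i _; exact: noise_moment2 eC _.
- by move=> i; exact/L4_L2/(noise_L4 eC).
- move=> i j ij; apply: (noise_orth eC _ (L2_L1 (L4_L2 (noise_L4 eC _)))).2.
  by apply: adapted_e => /= /phi_inj ij'; rewrite ij' eqxx in ij.
Qed.

Lemma Ex_nsum_sqr s k h : Ex P (fun w => nsum s k h w ^+ 2) <= C * h%:R.
Proof.
rewrite -[h in leRHS]card_ord.
apply: (@Ex_noise_sum_sqr _ (fun i : 'I_h => (k, (s, i : nat)))).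
by move=> i j [] /ord_inj.
Qed.

Lemma Ex_nsq s h : Ex P (nsq s h) <= C * h%:R * m%:R.
Proof.
rewrite Ex_sum => [|k]; last exact: (nsum_L2 _ _ _).2.
rewrite mulr_natr -[m in X in _ <= X]card_ord -sumr_const.
by apply: ler_sum => k _; exact: Ex_nsum_sqr.
Qed.

(** One step adds [2 A_k e_k + e_k^2] in each series; the cross terms are
    orthogonal to the crossing event, the squares are nonnegative. *)
Lemma nsq_submartingale lam s h :
  0 <= Ex P (fun w => \1_(exceeds lam (nsq s) h) w * (nsq s h.+1 w - nsq s h w)).
Proof.
set F := exceeds _ _ _.
pose f k w := 2 * (\1_F w * nsum s k h w).
have mG i : measurable_fun setT (nsq s i) by exact: (nsq_L2 _ _).1.
have f1 k : L1 P (f k) by apply/L1Z/L1_exceeds => //; exact/L2_L1/nsum_L2.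
have fo k : adapted e [set~ (k, (s, h))] (f k).
  apply: adaptedM; first exact: adapted_cst.
  apply: adaptedM.
    apply: exceeds_indic_adapted => i ih; apply: nsq_adapted => l j ji /= [_ jh].
    by rewrite jh ltnNge ih in ji.
  by apply: nsum_adapted => i ih /= [ih']; rewrite ih' ltnn in ih.
have -> : 0 = Ex P (fun w => \sum_k f k w * e (k, (s, h)) w).
  rewrite Ex_sum => [|k]; last exact: (noise_orth eC (fo k) (f1 k)).1.
  by rewrite big1// => k _; exact: (noise_orth eC (fo k) (f1 k)).2.
apply: Ex_le.
- by apply: L1_sum => k; exact: (noise_orth eC (fo k) (f1 k)).1.
- by apply: L1_exceeds => //; exact/L2_L1/L2B/nsq_L2/nsq_L2.
move=> w; rewrite /nsq -sumrB mulr_sumr; apply: ler_sum => k _.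
have /andP[h0 _] := indic_01 R F w.
rewrite nsumS /f; have := sqr_ge0 (e (k, (s, h)) w); nra.
Qed.

Section linear.
Context (s : bool) (b : 'I_m -> T -> R) (H : nat).
Context (b4 : forall k, L4 P (b k)).
Context (ba : forall k l i, (i < H)%N -> adapted e [set~ (l, (s, i))] (b k)).

Definition nlin (h : nat) (w : T) : R := \sum_k nsum s k h w * b k w.

Lemma nlin_L2 h : L2 P (nlin h).
Proof. by apply: L2_sum => k; apply: L4_mul => //; exact: nsum_L4. Qed.

Lemma nlin_submartingale lam h : (h < H)%N ->
  0 <= Ex P (fun w => \1_(exceeds lam (fun i w => nlin i w ^+ 2) h) w
              * (nlin h.+1 w ^+ 2 - nlin h w ^+ 2)).
Proof.
move=> hH; set F := exceeds _ _ _.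
pose f k w := 2 * (\1_F w * (nlin h w * b k w)).
have mG i : measurable_fun setT (fun w => nlin i w ^+ 2).
  by apply: measurable_funX; exact: (nlin_L2 _).1.
have f1 k : L1 P (f k).
  by apply/L1Z/L1_exceeds => //; apply: L2_mul; [exact: nlin_L2|exact: L4_L2].
have na k i : (i <= h)%N -> adapted e [set~ (k, (s, h))] (nlin i).
  move=> ih; apply: adapted_sum => l _; apply: adaptedM; last exact: ba.
  by apply: nsum_adapted => j ji /= [_ jh]; rewrite jh ltnNge ih in ji.
have fo k : adapted e [set~ (k, (s, h))] (f k).
  apply: adaptedM; first exact: adapted_cst.
  apply: adaptedM; last by apply: adaptedM; [exact: na|exact: ba].
  by apply: exceeds_indic_adapted => i ih; apply: adaptedX; exact: na.
have -> : 0 = Ex P (fun w => \sum_k f k w * e (k, (s, h)) w).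
  rewrite Ex_sum => [|k]; last exact: (noise_orth eC (fo k) (f1 k)).1.
  by rewrite big1// => k _; exact: (noise_orth eC (fo k) (f1 k)).2.
apply: Ex_le.
- by apply: L1_sum => k; exact: (noise_orth eC (fo k) (f1 k)).1.
- by apply: L1_exceeds => //; apply: L1B; exact: (nlin_L2 _).2.
move=> w; have /andP[h0 _] := indic_01 R F w.
have -> : \sum_k f k w * e (k, (s, h)) w =
    \1_F w * (2 * nlin h w * \sum_k e (k, (s, h)) w * b k w).
  rewrite /f; move: (nlin h w) => L.
  by rewrite !mulr_sumr; apply: eq_bigr => k _; ring.
have -> : nlin h.+1 w = nlin h w + \sum_k e (k, (s, h)) w * b k w.
  by rewrite /nlin -big_split; apply: eq_bigr => k _; rewrite nsumS /= mulrDl.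
apply: ler_wpM2l => //.
have := sqr_ge0 (\sum_k e (k, (s, h)) w * b k w); nra.
Qed.

(** The products [b_k e_{k,i}] are pairwise orthogonal. *)
Lemma Ex_nlin_sqr : Ex P (fun w => nlin H w ^+ 2) <=
  C * H%:R * \sum_k Ex P (fun w => b k w ^+ 2).
Proof.
have eL4 j : L4 P (e j) := noise_L4 eC j.
pose x (j : 'I_m * 'I_H) w := b j.1 w * e (j.1, (s, j.2 : nat)) w.
have -> : (fun w => nlin H w ^+ 2) = (fun w => (\sum_j x j w) ^+ 2).
  apply/funext => w; congr (_ ^+ 2); rewrite /nlin.
  under eq_bigr do rewrite mulr_suml.
  by rewrite pair_big /=; apply: eq_bigr => j _; rewrite mulrC.
rewrite Ex_sqr_sum.
- have bsq j : Ex P (fun w => x j w ^+ 2) <= C * Ex P (fun w => b j.1 w ^+ 2).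
    under eq_fun do rewrite exprMn.
    rewrite (noise_sqr eC _ _).2; last 2 first.
    + by apply: adaptedX; apply: ba.
    + exact: (L4_L2 (b4 _)).2.
    rewrite mulrC; apply: ler_wpM2r; last exact: noise_moment2 eC _.
    by apply: Ex_ge0 => w; exact: sqr_ge0.
  apply: (le_trans (ler_sum _ (fun j _ => bsq j))).
  rewrite -(pair_big xpredT xpredT (fun k (i : 'I_H) => C * Ex P (fun w => b k w ^+ 2)))/=.
  rewrite mulr_sumr; apply: ler_sum => k _.
  by rewrite sumr_const card_ord -[leLHS]mulr_natr [leRHS]mulrAC.
- by move=> j; apply: L4_mul.
- move=> [k i] [l j] ij; rewrite /x /=.
  have -> : (fun w => b k w * e (k, (s, i : nat)) w * (b l w * e (l, (s, j : nat)) w)) =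
    (fun w => (b k w * b l w * e (k, (s, i : nat)) w) * e (l, (s, j : nat)) w).
    by apply/funext => w; ring.
  apply: (noise_orth eC _ _).2.
    apply: adaptedM; first by apply: adaptedM; exact: ba.
    apply: adapted_e => /= -[kl ij']; move: ij.
    by rewrite kl (ord_inj ij') eqxx.
  by apply: L2_mul; [exact: L4_mul|exact: L4_L2].
Qed.

Lemma nlin_maximal lam :
  lam * Pr P (exceeds lam (fun i w => nlin i w ^+ 2) H) <=
  C * H%:R * \sum_k Ex P (fun w => b k w ^+ 2).
Proof.
apply: le_trans Ex_nlin_sqr; apply: doob_ge0.
- by move=> h; exact: (nlin_L2 _).2.
- by move=> w; exact: sqr_ge0.
- exact: nlin_submartingale.
Qed.

End linear.

Section square.
Context (s : bool) (H : nat).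

(* [x (k, i)] is the increment of the centred square [A_k(h)^2] from [h = i] to
   [i + 1]; these increments are pairwise orthogonal in [i] and in [k], which
   gives the variance of |A|^2 without expanding a fourth power of a sum. *)
Let sig (k : 'I_m) (i : nat) := Ex P (fun w => e (k, (s, i)) w ^+ 2).
Let x (j : 'I_m * 'I_H) w := 2 * nsum s j.1 j.2 w * e (j.1, (s, j.2 : nat)) w
  + (e (j.1, (s, j.2 : nat)) w ^+ 2 - sig j.1 j.2).

Let nsq_sum w : nsq s H w - \sum_k \sum_(i < H) sig k i = \sum_j x j w.
Proof.
rewrite -(pair_big xpredT xpredT (fun k i => x (k, i) w))/= /nsq -sumrB.
apply: eq_bigr => k _; rewrite /x /=.
elim: H => [|h IH]; first by rewrite /nsum !big_ord0 expr0n subrr.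
rewrite !big_ord_recr/= -IH nsumS; ring.
Qed.

Let x_L2 j : L2 P (x j).
Proof.
have e4 := noise_L4 eC (j.1, (s, j.2 : nat)).
apply: L2D.
  under eq_fun do rewrite -mulrA.
  by apply: L2Z; apply: L4_mul => //; exact: nsum_L4.
by apply: L2B; [exact: L4_sqr|exact: L2_cst].
Qed.

(* The later of two increments, or any one of another series, involves a fresh
   variable that the first increment does not see. *)
Let x_orth_lt (i j : 'I_m * 'I_H) : (i.1 != j.1) || (i.2 < j.2)%N ->
  Ex P (fun w => x i w * x j w) = 0.
Proof.
move=> ij.
have xa : adapted e [set~ (j.1, (s, j.2 : nat))] (x i).
  have ea : adapted e [set~ (j.1, (s, j.2 : nat))] (e (i.1, (s, i.2 : nat))).
    by apply: adapted_e => /= -[h1 h2]; move: ij; rewrite h1 h2 eqxx ltnn.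
  apply: adaptedD; last first.
    by apply: adaptedD; [exact: adaptedX|exact: adapted_cst].
  apply: adaptedM => //; apply: adaptedM; first exact: adapted_cst.
  apply: nsum_adapted => l li /= [h1 h2]; move: ij; rewrite h1 eqxx/=.
  by rewrite -h2 ltnNge (ltnW li).
have na : adapted e [set~ (j.1, (s, j.2 : nat))] (nsum s j.1 j.2).
  by apply: nsum_adapted => l lj /= [lj']; rewrite lj' ltnn in lj.
set ej := e (j.1, (s, j.2 : nat)).
pose f w := 2 * (x i w * nsum s j.1 j.2 w).
have f1 : L1 P f by apply/L1Z/L2_mul => //; exact: nsum_L2.
have fa : adapted e [set~ (j.1, (s, j.2 : nat))] f.
  by apply: adaptedM; [exact: adapted_cst|exact: adaptedM].
have [fe1 fe0] := noise_orth eC fa f1.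
have [xe1 xe0] := noise_sqr eC xa (L2_L1 (x_L2 i)).
have -> : (fun w => x i w * x j w) =
    (fun w => f w * ej w + (x i w * ej w ^+ 2 - sig j.1 j.2 * x i w)).
  by apply/funext => w; rewrite /f /ej [x j]/x; ring.
have xs := L1Z (sig j.1 j.2) (L2_L1 (x_L2 i)).
rewrite ExD//; last exact: L1B.
by rewrite fe0 ExB// xe0 ExZ; [rewrite /sig; ring|exact: L2_L1].
Qed.

Let x_sqr j : Ex P (fun w => x j w ^+ 2) <= 8 * C ^+ 2 * H%:R.
Proof.
set ej := e (j.1, (s, j.2 : nat)); set A := nsum s j.1 j.2.
have C1 := noise_ge1 eC; have C0 : 0 <= C by lra.
have e4 := noise_L4 eC (j.1, (s, j.2 : nat)).
have na : adapted e [set~ (j.1, (s, j.2 : nat))] (fun w => A w ^+ 2).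
  by apply: adaptedX; apply: nsum_adapted => l lj /= [lj']; rewrite lj' ltnn in lj.
have [ae1 aeE] := noise_sqr eC na (nsum_L2 s j.1 j.2).2.
have sC : sig j.1 j.2 <= C := noise_moment2 eC _.
have e2 := (L4_L2 e4).2.
have s2 := L1Z (2 * sig j.1 j.2) e2.
have e4s := L1B e4.2 s2.
have e4ss := L1D e4s (L1_cst P (sig j.1 j.2 ^+ 2)).
have : Ex P (fun w => x j w ^+ 2) <= Ex P (fun w => 8 * (A w ^+ 2 * ej w ^+ 2)
    + 2 * (ej w ^+ 4 - 2 * sig j.1 j.2 * ej w ^+ 2 + sig j.1 j.2 ^+ 2)).
  apply: Ex_le; first exact: (x_L2 j).2.
    by apply: L1D; apply: L1Z.
  move=> w; rewrite /x -/ej -/A.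
  have := sqr_ge0 (2 * A w * ej w - (ej w ^+ 2 - sig j.1 j.2)).
  rewrite -subr_ge0 => h; rewrite -subr_ge0; move: h; congr (_ <= _); ring.
rewrite ExD ?ExZ//; [|exact: L1Z|exact: L1Z].
rewrite ExD ?ExB ?ExZ ?Ex_cst//; [|exact: L1_cst|exact: e4.2|exact: L1_cst].
rewrite aeE -/ej => h; apply: (le_trans h).
have h4 : Ex P (fun w => ej w ^+ 4) <= C := noise_moment4 eC _.
have hA : Ex P (fun w => A w ^+ 2) <= C * (j.2)%:R by exact: Ex_nsum_sqr.
have jH : (j.2)%:R + 1 <= H%:R :> R by rewrite natr1 ler_nat ltn_ord.
have s0 : 0 <= sig j.1 j.2 by apply: Ex_ge0 => w; exact: sqr_ge0.
have A0 : 0 <= Ex P (fun w => A w ^+ 2) by apply: Ex_ge0 => w; exact: sqr_ge0.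
rewrite -/(sig j.1 j.2).
have hAs : Ex P (fun w => A w ^+ 2) * sig j.1 j.2 <= C * j.2%:R * C by exact: ler_pM.
have hs : 0 <= sig j.1 j.2 * sig j.1 j.2 by exact: mulr_ge0.
have hC : C <= C * C by rewrite ler_peMl.
have hCj : C * C * (j.2%:R + 1) <= C * C * H%:R.
  by apply: ler_wpM2l => //; exact: mulr_ge0.
nra.
Qed.

(** Here [C H m] bounds the mean of the square norm, so a level twice as large
    leaves [lam - v >= lam / 2] in [doob_var]. *)
Lemma nsq_maximal lam : 2 * (C * H%:R * m%:R) <= lam ->
  lam ^+ 2 * Pr P (exceeds lam (nsq s) H) <= 32 * (C ^+ 2 * H%:R ^+ 2 * m%:R).
Proof.
move=> hlam; set v := \sum_k \sum_(i < H) sig k i.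
have hv : v <= C * H%:R * m%:R.
  rewrite mulr_natr -[m in X in _ <= X]card_ord -sumr_const.
  apply: ler_sum => k _.
  rewrite mulr_natr -[H in X in _ <= X]card_ord -sumr_const.
  by apply: ler_sum => i _; exact: noise_moment2 eC _.
have v0 : 0 <= v.
  by do 2 (apply: sumr_ge0 => ? _); apply: Ex_ge0 => w; exact: sqr_ge0.
have vlam : v <= lam by lra.
have hd := @doob_var _ _ _ P lam v (nsq s) H (fun h => L2_L1 (nsq_L2 s h))
  (nsq_L2 s H) vlam (fun h _ => nsq_submartingale lam s h).
have hx : Ex P (fun w => (nsq s H w - v) ^+ 2) <= 8 * (C ^+ 2 * H%:R ^+ 2 * m%:R).
  under eq_fun do rewrite nsq_sum.
  rewrite Ex_sqr_sum//; last first.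
    move=> i j ij; case: (boolP ((i.1 != j.1) || (i.2 < j.2)%N)).
      exact: x_orth_lt.
    rewrite negb_or negbK -leqNgt => /andP[/eqP i1 ji].
    under eq_fun do rewrite mulrC.
    apply: x_orth_lt; rewrite ltn_neqAle ji andbT; apply/orP; right.
    apply: contraNN ij => /eqP/ord_inj j2; case: i j i1 j2 {ji} => [a b] [a' b'] /=.
    by move=> -> ->.
  apply: (le_trans (ler_sum _ (fun j _ => x_sqr j))).
  rewrite sumr_const card_prod !card_ord -[leLHS]mulr_natl natrM; nra.
have p0 := Pr_ge0 P (exceeds lam (nsq s) H).
have : lam ^+ 2 <= 4 * (lam - v) ^+ 2 by nra.
move=> /(ler_wpM2r p0); lra.
Qed.

End square.

End noise_maximal.

(** * Deterministic comparison of two splits *)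

Section comparison.
Context (R : realType).

(** [a], [b], [l] are the sums of one series over the part of the side beyond the
    candidate, between the two splits, and over the opposite side, with means
    [u] on the side of the candidate and [v] on the other.  For fixed data, the
    fit improves with the sum over blocks of (block sum)^2 / (block length);
    the identity is the between-groups decomposition, used once for merging the
    first two blocks and once for the last two. *)
Lemma split_gain (p q h u v A B Q : R) : 0 < h -> h < p -> 0 < q ->
  let a := (p - h) * u + (Q - A) in let b := h * u + A in let l := q * v + B in
  (a + b) ^+ 2 / p + l ^+ 2 / q - (a ^+ 2 / (p - h) + (b + l) ^+ 2 / (q + h)) =
  h * (q / (q + h) * (u - v + A / h - B / q) ^+ 2
       - (p - h) / p * ((Q - A) / (p - h) - A / h) ^+ 2).
Proof.
move=> h0 hp q0 a b l; rewrite /a /b /l.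
field.
by rewrite !gt_eqF//; lra.
Qed.

(** Expand both squares and use [(d - be)^2 >= d^2 / 2 - be^2] and
    [(y - z)^2 <= 2 y^2 + 2 z^2].  The squares of [A / h] are kept with the
    coefficient [rho - kap], which is small: bounding them separately would
    lose a term of the order of |A|^2 / h^2, which need not be small compared
    with [D]. *)
Lemma gain_lower (rho kap h q j d A B Q : R) : 0 < h -> 0 < q -> 0 < j ->
  0 <= rho -> 0 <= kap ->
  rho * (d ^+ 2 / 2 - B ^+ 2 / q ^+ 2) + 2 * rho * (A * d / h - A * B / (h * q))
  + (rho - kap) * (A ^+ 2 / h ^+ 2) - 2 * kap * ((Q ^+ 2 + A ^+ 2) / j ^+ 2)
  + 2 * kap * ((A * Q - A ^+ 2) / (j * h)) <=
  rho * (d + A / h - B / q) ^+ 2 - kap * ((Q - A) / j - A / h) ^+ 2.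
Proof.
move=> h0 q0 j0 r0 k0.
set al := A / h; set be := B / q; set ga := Q / j; set ga' := A / j.
have -> : B ^+ 2 / q ^+ 2 = be ^+ 2 by rewrite /be exprMn exprVn.
have -> : A * d / h = al * d by rewrite /al mulrAC.
have -> : A * B / (h * q) = al * be by rewrite /al /be; field; rewrite !gt_eqF.
have -> : A ^+ 2 / h ^+ 2 = al ^+ 2 by rewrite /al exprMn exprVn.
have -> : (Q ^+ 2 + A ^+ 2) / j ^+ 2 = ga ^+ 2 + ga' ^+ 2.
  by rewrite /ga /ga'; field; rewrite !gt_eqF.
have -> : (A * Q - A ^+ 2) / (j * h) = al * (ga - ga').
  by rewrite /ga /ga' /al; field; rewrite !gt_eqF.
have -> : (Q - A) / j = ga - ga' by rewrite mulrBl.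
have h1 := mulr_ge0 r0 (sqr_ge0 (d - 2 * be)).
have h2 := mulr_ge0 k0 (sqr_ge0 (ga + ga')).
lra.
Qed.

Lemma weighted_gain_positive (rho kap c D t1 t2 t3 t4 t5 t6 : R) :
  0 < c -> c <= 1 -> 0 < D -> c <= rho -> rho <= 1 -> 0 <= kap -> kap <= 1 ->
  t1 <= c * D / 64 -> - (c * D / 64) <= t2 -> t3 <= c * D / 64 ->
  - (c * D / 64) <= t4 -> t5 <= c * D / 32 -> - (3 * c * D / 64) <= t6 ->
  0 < rho * (D / 2 - t1) + 2 * rho * (t2 - t3) + t4 - 2 * kap * t5 + 2 * kap * t6.
Proof.
move=> c0 c1 D0 cr r1 k0 k1 b1 b2 b3 b4 b5 b6.
have cD0 : 0 < c * D by exact: mulr_gt0.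
have v0 : 0 <= c * D / 64 by lra.
have r0 : 0 <= rho by lra.
have cDD : c * D <= D by rewrite ler_piMl// ltW.
have g1 : c * (D / 2 - c * D / 64) <= rho * (D / 2 - t1).
  apply: (@le_trans _ _ (rho * (D / 2 - c * D / 64))).
    by apply: ler_wpM2r => //; lra.
  by apply: ler_wpM2l => //; lra.
have t : - (2 * (c * D / 64)) <= t2 - t3 by lra.
have g2 := ler_wpM2l r0 t; have g2' := ler_wpM2r v0 r1.
have g3 := ler_wpM2l k0 b5; have g3' := ler_wpM2r v0 k1.
have g4 := ler_wpM2l k0 b6.
have g5 : c * (c * D) <= c * D by rewrite ler_piMl// ltW.
lra.
Qed.

(** After summation over the series, each of the noise terms is at most a small
    multiple of [c D], while the signal term is at least [c D / 2]; the value
    [u = c^3 D / 64] leaves room for all of them together. *)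
Lemma gain_positive (m : nat) (A B Q d : 'I_m -> R) (n p q h c D u : R) :
  64 * u = c ^+ 3 * D ->
  0 < c -> c <= 1 -> 0 < D -> 0 < q -> 1 <= h -> h < p -> p + q = n ->
  c * n <= q -> c * n <= p - h ->
  D = \sum_k d k ^+ 2 ->
  \sum_k B k ^+ 2 <= u * n ^+ 2 -> \sum_k Q k ^+ 2 <= u * n ^+ 2 ->
  \sum_k A k ^+ 2 <= u * h * n ->
  `|\sum_k A k * B k| <= u * h * n ->
  `|\sum_k A k * Q k| <= 2 * (u * h * n) ->
  `|\sum_k A k * d k| <= u * h ->
  0 < \sum_k (q / (q + h) * (d k + A k / h - B k / q) ^+ 2
       - (p - h) / p * ((Q k - A k) / (p - h) - A k / h) ^+ 2).
Proof.
move=> uE c0 c1 D0 q0 h1 hp pqn cq cj DE hB hQ hA hAB hAQ hAd.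
have h0 : 0 < h by lra.
have p0 : 0 < p by lra.
have n0 : 0 < n by lra.
have qh0 : 0 < q + h by lra.
set rho := q / (q + h); set kap := (p - h) / p.
have [j jE] : exists j, j = p - h by exists (p - h).
rewrite -jE in cj kap *.
have j0 : 0 < j by lra.
have r0 : 0 <= rho by rewrite divr_ge0 ?ltW.
have k0 : 0 <= kap by rewrite divr_ge0 ?ltW.
have rc : c <= rho.
  have : c * (q + h) <= c * n by rewrite ler_pM2l//; lra.
  by rewrite ler_pdivlMr// => /le_trans; exact.
have k1 : kap <= 1 by rewrite ler_pdivrMr// mul1r; lra.
have r1 : rho <= 1 by rewrite ler_pdivrMr// mul1r; lra.
(* The two weights differ by [O(h / n)] only. *)
have rk : - (h / q) <= rho - kap.
  have -> : rho - kap = h / p - h / (q + h).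
    by rewrite /rho /kap jE; field; rewrite !gt_eqF.
  have : 0 <= h / p by rewrite divr_ge0// ltW.
  have : h / (q + h) <= h / q by rewrite ler_pM2l// lef_pV2 ?posrE// lerDl ltW.
  by clear; lra.
have u0 : 0 < u by rewrite -(pmulr_rgt0 _ (_ : 0 < 64))// uE mulr_gt0 ?exprn_gt0.
have hn : u * h * n <= u * n ^+ 2.
  by rewrite expr2 mulrA ler_pM2r// ler_pM2l//; lra.
have cn0 : 0 <= c * n by rewrite mulr_ge0 ?ltW.
have cj2 : (c * n) ^+ 2 <= j ^+ 2 by rewrite lerXn2r// nnegrE// ltW.
have cq2 : (c * n) ^+ 2 <= q ^+ 2 by rewrite lerXn2r// nnegrE// ltW.
have [v vE] : exists v, v = c * D / 64 by eexists.
have uc : u = v * c ^+ 2.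
  by rewrite vE -[u](mulKf (_ : 64 != 0)) ?pnatr_eq0// uE; field.
have v0 : 0 < v by rewrite vE divr_gt0// mulr_gt0.
have un2 : u * n ^+ 2 = v * (c * n) ^+ 2 by rewrite uc; ring.
have un : u * n <= v * (c * n).
  rewrite uc (_ : v * c ^+ 2 * n = c * (v * (c * n))); last by ring.
  by rewrite ler_piMl// mulr_ge0// ltW.
have sA_ge0 : 0 <= \sum_k A k ^+ 2 by apply: sumr_ge0 => k _; exact: sqr_ge0.
apply: (@lt_le_trans _ _ (rho * (D / 2 - (\sum_k B k ^+ 2) / q ^+ 2)
  + 2 * rho * ((\sum_k A k * d k) / h - (\sum_k A k * B k) / (h * q))
  + (rho - kap) * ((\sum_k A k ^+ 2) / h ^+ 2)
  - 2 * kap * ((\sum_k Q k ^+ 2 + \sum_k A k ^+ 2) / j ^+ 2)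
  + 2 * kap * ((\sum_k A k * Q k - \sum_k A k ^+ 2) / (j * h)))); last first.
  apply: le_trans (ler_sum _ (fun k _ =>
    gain_lower (d k) (A k) (B k) (Q k) h0 q0 j0 r0 k0)).
  rewrite !big_split/= !sumrN -!mulr_sumr !big_split/= !sumrN -!mulr_suml.
  by rewrite !big_split/= !sumrN DE.
clearbody rho kap; clear DE jE hp.
move: sA_ge0 hB hQ hA hAB hAQ hAd.
move: (\sum_k B k ^+ 2) (\sum_k Q k ^+ 2) (\sum_k A k ^+ 2) (\sum_k A k * B k)
  (\sum_k A k * Q k) (\sum_k A k * d k) => sB sQ sA sAB sAQ sAd {A B Q d}.
rewrite !ler_norml => sA_ge0 hB hQ hA /andP[_ hAB] /andP[hAQ _] /andP[hAd _].
have unq : u * n <= v * q by apply: (le_trans un); rewrite ler_pM2l.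
have unj : u * n <= v * j by apply: (le_trans un); rewrite ler_pM2l.
apply: (weighted_gain_positive c0 c1 D0 rc r1 k0 k1).
- rewrite -vE ler_pdivrMr ?exprn_gt0// (le_trans hB)// un2.
  by rewrite ler_pM2l.
- rewrite -vE ler_pdivlMr// mulNr; apply: le_trans hAd; rewrite lerN2.
  rewrite ler_pM2r// uc ler_piMr//; first exact: ltW.
  by apply: exprn_ile1 => //; exact: ltW.
- rewrite -vE ler_pdivrMr ?mulr_gt0// (le_trans hAB)//.
  by rewrite mulrAC [h * q]mulrC mulrA ler_pM2r.
- have sA0 : 0 <= sA / h ^+ 2 by rewrite divr_ge0 ?sqr_ge0.
  apply: le_trans (ler_wpM2r sA0 rk); rewrite -vE mulNr lerN2.
  have -> : h / q * (sA / h ^+ 2) = sA / (h * q) by field; rewrite !gt_eqF.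
  rewrite ler_pdivrMr ?mulr_gt0// (le_trans hA)//.
  by rewrite mulrAC [h * q]mulrC mulrA ler_pM2r.
- have -> : c * D / 32 = 2 * v by rewrite vE; field.
  rewrite ler_pdivrMr ?exprn_gt0//.
  have := ler_wpM2l (ltW v0) cj2; rewrite -un2; move: hQ hA hn; clear; lra.
- have -> : 3 * c * D / 64 = 3 * v by rewrite vE; field.
  rewrite ler_pdivlMr ?mulr_gt0//.
  have := ler_wpM2l (ltW h0) unj; move: hAQ hA; clear; lra.
Qed.

(** The sum starts at the first [i] with [2^(i+1) > t], and is at most twice its
    first term [2^(-i) < 2 / t].  The induction keeps the part of the full
    geometric series not yet reached. *)
Lemma geometric_tail (t : R) (n : nat) : 0 < t ->
  \sum_(i < n) (if t < 2 ^+ i.+1 then (2 ^+ i)^-1 else 0) <= 4 / t.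
Proof.
move=> t0; suff : \sum_(i < n) (if t < 2 ^+ i.+1 then (2 ^+ i)^-1 else 0) <=
    if t < 2 ^+ n then 4 / t - 2 * (2 ^+ n)^-1 else 0.
  move=> h; apply: (le_trans h); case: ifP => _; last by rewrite divr_ge0// ltW.
  by rewrite gerBl mulr_ge0// invr_ge0 exprn_ge0.
elim: n => [|n IH].
  rewrite big_ord0 expr0; case: ifP => // t1; rewrite invr1 mulr1 subr_ge0.
  by rewrite ler_pdivlMr//; lra.
rewrite big_ord_recr/=; set z : R := 2 ^+ n in IH *.
have z0 : 0 < z by rewrite exprn_gt0.
have zE : 2 ^+ n.+1 = 2 * z by rewrite exprS.
rewrite zE (_ : 2 * (2 * z)^-1 = z^-1); last by field; rewrite gt_eqF.
case: (ltP t z) IH => tz IH.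
  have -> : t < 2 * z by lra.
  lra.
case: ifP => t2z; last by lra.
have : 2 / z <= 4 / t by rewrite ler_pdivrMr// mulrAC ler_pdivlMr//; lra.
lra.
Qed.

End comparison.

(** * Noise on one side of the change point *)

Section one_sided.
Context (R : realType) (d : measure_display) (T : measurableType d).
Context (P : probability T R) (m : nat).
Context (e : 'I_m * (bool * nat) -> T -> R) (C : R) (eC : white_noise P e C).

Definition rest (H p : nat) (k : 'I_m) (w : T) : R :=
  \sum_(i < p - H) e (k, (true, (H + i)%N)) w.

Lemma nsum_rest H p k w : (H <= p)%N ->
  nsum e true k p w = nsum e true k H w + rest H p k w.
Proof.
move=> Hp; have [a ->] : exists a, p = (H + a)%N by exists (p - H)%N; rewrite subnKC.
by rewrite /nsum /rest addKn big_split_ord.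
Qed.

Lemma rest_L4 H p k : L4 P (rest H p k).
Proof. by apply: L4_sum => i; exact: noise_L4 eC _. Qed.

Lemma Ex_rest_sqr H p k : Ex P (fun w => rest H p k w ^+ 2) <= C * p%:R.
Proof.
apply: (@le_trans _ _ (C * (p - H)%N%:R)).
  rewrite -[(p - H)%N in leRHS]card_ord.
  apply: (@Ex_noise_sum_sqr _ _ _ _ _ _ _ eC _
    (fun i : 'I_(p - H) => (k, (true, (H + i)%N)))).
  by move=> i j [] /addnI/ord_inj.
rewrite ler_wpM2l ?ler_nat ?leq_subr//; exact: noise_C0 eC.
Qed.

Context (del : 'I_m -> R) (D : R).
Context (DE : D = \sum_k del k ^+ 2).

(** [y] is the level for quadratic expressions in the noise, [z] the one for the
    inner product with the jump; the squares only serve to bound absolute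
    values by [nlin_maximal]. *)
Definition bad_block (p q H : nat) (y z : R) : set T :=
  exceeds y (nsq e true) H `|`
  exceeds (y ^+ 2) (fun h w => nlin e true (fun k => nsum e false k q) h w ^+ 2) H `|`
  exceeds (y ^+ 2) (fun h w => nlin e true (rest H p) h w ^+ 2) H `|`
  exceeds (z ^+ 2) (fun h w => nlin e true (fun k => fun=> del k) h w ^+ 2) H.

Let b4B q k : L4 P (nsum e false k q) := nsum_L4 eC false k q.
Let b4d k : L4 P (fun=> del k) := L4_cst P (del k).

Lemma measurable_bad_block p q H y z : measurable (bad_block p q H y z).
Proof.
apply: measurableU; first (apply: measurableU; first apply: measurableU).
- by apply: measurable_exceeds => i; exact: (nsq_L2 eC true i).1.
- apply: measurable_exceeds => i; apply: measurable_funX.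
  exact: (nlin_L2 eC true (b4B q) i).1.
- apply: measurable_exceeds => i; apply: measurable_funX.
  exact: (nlin_L2 eC true (rest_L4 H p) i).1.
- apply: measurable_exceeds => i; apply: measurable_funX.
  exact: (nlin_L2 eC true b4d i).1.
Qed.

(** For the product of [A(h)] with the sum over the whole side, split the latter
    at [H]: the product with [A(H)] is at most (|A(h)|^2 + |A(H)|^2) / 2, and
    the rest is independent of [A(h)]. *)
Lemma bad_blockPn p q H y z w h : 0 <= y -> 0 <= z -> (H <= p)%N -> (h <= H)%N ->
  ~ bad_block p q H y z w ->
  [/\ \sum_k nsum e true k h w ^+ 2 <= y,
      `|\sum_k nsum e true k h w * nsum e false k q w| <= y,
      `|\sum_k nsum e true k h w * nsum e true k p w| <= 2 * y &
      `|\sum_k nsum e true k h w * del k| <= z].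
Proof.
move=> y0 z0 Hp hH nbad.
have sq_le a b : 0 <= b -> ~ b ^+ 2 < a ^+ 2 -> `|a| <= b :> R.
  move=> b0 /negP; rewrite -leNgt => ab.
  by rewrite -(ler_pXn2r (_ : (0 < 2)%N)) ?nnegrE// real_normK ?num_real.
have nE h' : (h' <= H)%N -> \sum_k nsum e true k h' w ^+ 2 <= y.
  move=> h'H; rewrite leNgt; apply/negP => hy; apply: nbad; left; left; left.
  by apply/exceedsP; exists h'.
have hR : `|\sum_k nsum e true k h w * rest H p k w| <= y.
  apply: sq_le => // hy; apply: nbad; left; right.
  by apply/exceedsP; exists h.
split; first exact: nE.
- apply: sq_le => // hy; apply: nbad; left; left; right.
  by apply/exceedsP; exists h.
- have -> : \sum_k nsum e true k h w * nsum e true k p w =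
    \sum_k nsum e true k h w * nsum e true k H w +
    \sum_k nsum e true k h w * rest H p k w.
    by rewrite -big_split; apply: eq_bigr => k _; rewrite (nsum_rest _ _ Hp)/= mulrDr.
  apply: (le_trans (ler_normD _ _)).
  rewrite (_ : 2 * y = y + y); last by ring.
  apply: lerD => //.
  apply: (le_trans (ler_norm_sum _ _ _)).
  apply: (@le_trans _ _ (\sum_k (nsum e true k h w ^+ 2 + nsum e true k H w ^+ 2) / 2)).
    apply: ler_sum => k _; rewrite normrM.
    have := sqr_ge0 (`|nsum e true k h w| - `|nsum e true k H w|).
    rewrite -(real_normK (num_real (nsum e true k h w))).
    rewrite -(real_normK (num_real (nsum e true k H w))); lra.
  by rewrite -mulr_suml big_split/=; have := nE _ hH; have := nE _ (leqnn H); lra.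
- apply: sq_le => // hy; apply: nbad; right.
  by apply/exceedsP; exists h.
Qed.

(** The crossing of |A|^2 contributes 128, the products with [B] and with the rest
    2 each, and the product with the jump 2: this makes 134.  The truncation of
    the block at [p] covers the last, incomplete block. *)
Lemma Pr_bad_block (p q n i : nat) (u : R) :
  let H := minn (2 ^ i.+1) p in
  0 < u -> (2 ^ i <= p)%N -> (p <= n)%N -> (q <= n)%N -> (0 < n)%N ->
  m%:R <= n%:R * D -> 4 * C * m%:R <= u * n%:R ->
  Pr P (bad_block p q H (u * 2 ^+ i * n%:R) (u * 2 ^+ i)) <=
  134 * C ^+ 2 * D / u ^+ 2 * (2 ^+ i)^-1.
Proof.
move=> H u0 ip pn qn n0 mD Cm.
have C1 := noise_ge1 eC; have C0 : 0 < C by lra.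
set Z : R := 2 ^+ i; set N : R := n%:R.
have Z0 : 0 < Z by rewrite exprn_gt0.
have N0 : 0 < N by rewrite ltr0n.
have HZ : H%:R <= 2 * Z :> R.
  by rewrite -exprS -natrX ler_nat /H geq_minl.
have ZN : Z <= N by rewrite /Z /N -natrX ler_nat (leq_trans ip).
have D0 : 0 <= D by rewrite DE; apply: sumr_ge0 => k _; exact: sqr_ge0.
have H0 : 0 <= H%:R :> R by [].
have m0 : 0 <= m%:R :> R by [].
set Y := u * Z * N; have Y0 : 0 < Y by rewrite !mulr_gt0.
have uZ0 : 0 < u * Z by rewrite mulr_gt0.
have bound (A x : R) : 0 < x -> x * A <= x * (C ^+ 2 * D / u ^+ 2 * Z^-1) ->
  A <= C ^+ 2 * D / u ^+ 2 * Z^-1 by move=> x0; rewrite ler_pM2l.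
have hsq : Y ^+ 2 * Pr P (exceeds Y (nsq e true) H) <=
    Y ^+ 2 * (128 * (C ^+ 2 * D / u ^+ 2 * Z^-1)).
  apply: (le_trans (nsq_maximal eC true _)).
    have : C * m%:R * H%:R <= C * m%:R * (2 * Z) by rewrite ler_wpM2l// mulr_ge0// ltW.
    have := ler_wpM2r (ltW Z0) Cm; rewrite /Y; lra.
  have -> : Y ^+ 2 * (128 * (C ^+ 2 * D / u ^+ 2 * Z^-1)) = 128 * C ^+ 2 * (N * D) * (N * Z).
    by rewrite /Y; field; rewrite !gt_eqF.
  have hH2 : H%:R ^+ 2 <= (2 * Z) ^+ 2 :> R by rewrite lerXn2r// nnegrE mulr_ge0// ltW.
  have h1 : H%:R ^+ 2 * m%:R <= 4 * (N * Z) * (N * D).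
    apply: (@le_trans _ _ ((2 * Z) ^+ 2 * (N * D))).
      by apply: ler_pM => //; exact: sqr_ge0.
    apply: ler_wpM2r; first by rewrite mulr_ge0// ltW.
    have := ler_wpM2r (ltW Z0) ZN; lra.
  have := ler_wpM2l (sqr_ge0 C) h1; lra.
have hlin (b : 'I_m -> T -> R) (t : nat) : (t <= n)%N -> (forall k, L4 P (b k)) ->
    (forall k l j, (j < H)%N -> adapted e [set~ (l, (true, j))] (b k)) ->
    (forall k, Ex P (fun w => b k w ^+ 2) <= C * t%:R) ->
    Y ^+ 2 * Pr P (exceeds (Y ^+ 2) (fun h w => nlin e true b h w ^+ 2) H) <=
    Y ^+ 2 * (2 * (C ^+ 2 * D / u ^+ 2 * Z^-1)).
  move=> tn b4 ba bE; apply: (le_trans (nlin_maximal eC b4 ba _)).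
  have -> : Y ^+ 2 * (2 * (C ^+ 2 * D / u ^+ 2 * Z^-1)) = C * (2 * Z) * ((N * D) * (C * N)).
    by rewrite /Y; field; rewrite !gt_eqF.
  apply: ler_pM.
  - by rewrite mulr_ge0// ltW.
  - by apply: sumr_ge0 => k _; apply: Ex_ge0 => w; exact: sqr_ge0.
  - by rewrite ler_pM2l.
  - apply: (@le_trans _ _ (m%:R * (C * N))); last first.
      by apply: ler_wpM2r => //; rewrite mulr_ge0// ltW.
    rewrite mulrC mulr_natr -[m in leRHS]card_ord -sumr_const.
    apply: ler_sum => k _; apply: (le_trans (bE k)).
    by rewrite ler_pM2l// ler_nat.
have hB := hlin _ q qn (b4B q) _ (fun k => Ex_nsum_sqr eC false k q).
have hL := hlin _ p pn (rest_L4 H p) _ (fun k => Ex_rest_sqr H p k).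
have hd : (u * Z) ^+ 2 * Pr P (exceeds ((u * Z) ^+ 2)
      (fun h w => nlin e true (fun k => fun=> del k) h w ^+ 2) H) <=
    (u * Z) ^+ 2 * (2 * (C ^+ 2 * D / u ^+ 2 * Z^-1)).
  apply: (le_trans (nlin_maximal eC b4d _ _)).
    by move=> k l j _; exact: adapted_cst.
  have -> : (u * Z) ^+ 2 * (2 * (C ^+ 2 * D / u ^+ 2 * Z^-1)) = C * C * (2 * Z) * D.
    by field; rewrite !gt_eqF.
  have -> : \sum_k Ex P (fun=> del k ^+ 2) = D.
    by rewrite DE; apply: eq_bigr => k _; rewrite Ex_cst.
  apply: ler_wpM2r => //; apply: ler_pM => //; first exact: ltW.
  by rewrite ler_peMl// ltW.
have {}hB := hB _; have {}hL := hL _.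
have Y20 : 0 < Y ^+ 2 by rewrite exprn_gt0.
have uZ20 : 0 < (u * Z) ^+ 2 by rewrite exprn_gt0.
move: hsq; rewrite ler_pM2l// => hsq.
move: hd; rewrite ler_pM2l// => hd.
have {}hB : Pr P (exceeds (Y ^+ 2)
   (fun h w => nlin e true (fun k => nsum e false k q) h w ^+ 2) H) <=
   2 * (C ^+ 2 * D / u ^+ 2 * Z^-1).
  rewrite -(ler_pM2l Y20); apply: hB => k l j _; apply: nsum_adapted => a _ /= [].
  by [].
have {}hL : Pr P (exceeds (Y ^+ 2) (fun h w => nlin e true (rest H p) h w ^+ 2) H) <=
   2 * (C ^+ 2 * D / u ^+ 2 * Z^-1).
  rewrite -(ler_pM2l Y20); apply: hL => k l j jH.
  apply: adapted_sum => a _; apply: adapted_e => /= -[_ aj].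
  by move: jH; rewrite -aj ltnNge leq_addr.
have m1 : measurable (exceeds Y (nsq e true) H).
  by apply: measurable_exceeds => j; exact: (nsq_L2 eC true j).1.
have mb b lam : (forall k, L4 P (b k)) ->
    measurable (exceeds lam (fun h w => nlin e true b h w ^+ 2) H).
  move=> b4; apply: measurable_exceeds => j; apply: measurable_funX.
  exact: (nlin_L2 eC true b4 j).1.
have m2 := mb _ (Y ^+ 2) (b4B q); have m3 := mb _ (Y ^+ 2) (rest_L4 H p).
have m4 := mb _ ((u * Z) ^+ 2) b4d.
have m12 := measurableU _ _ m1 m2; have m123 := measurableU _ _ m12 m3.
have u1 := PrU P m1 m2; have u2 := PrU P m12 m3; have u3 := PrU P m123 m4.
have -> : 134 * C ^+ 2 * D / u ^+ 2 / Z = 134 * (C ^+ 2 * D / u ^+ 2 * Z^-1) by ring.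
move: u1 u2 u3 hsq hB hL hd; rewrite /bad_block.
move: (C ^+ 2 * D / u ^+ 2 * Z^-1) => W; clear; lra.
Qed.

(** Union bound over the dyadic blocks that reach beyond [K / D], together with
    Markov's inequality for the two complete sides; a distance [h] is treated in
    the block of [trunc_log 2 h]. *)
Lemma one_sided (p q n : nat) (c u K : R) :
  (p + q = n)%N -> (0 < p)%N -> (0 < q)%N -> 0 < c -> c <= 1 -> c * n%:R <= q%:R ->
  0 < D -> 0 < K -> 64 * u = c ^+ 3 * D ->
  m%:R <= n%:R * D -> 4 * C * m%:R <= u * n%:R ->
  exists Bad : set T, [/\ measurable Bad,
    Pr P Bad <= 536 * C ^+ 2 * D ^+ 2 / (u ^+ 2 * K) + 2 * (C * m%:R / (u * n%:R)) &
    forall w, ~ Bad w -> forall h : nat, (0 < h < p)%N ->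
      K < h%:R * D -> c * n%:R <= p%:R - h%:R ->
      0 < \sum_k (q%:R / (q%:R + h%:R) *
          (del k + nsum e true k h w / h%:R - nsum e false k q w / q%:R) ^+ 2
       - (p%:R - h%:R) / p%:R *
          ((nsum e true k p w - nsum e true k h w) / (p%:R - h%:R)
            - nsum e true k h w / h%:R) ^+ 2)].
Proof.
move=> pqn p0 q0 c0 c1 cq D0 K0 uE mD Cm.
have C0 := noise_C0 eC.
have u0 : 0 < u by rewrite -(pmulr_rgt0 _ (_ : 0 < 64))// uE mulr_gt0 ?exprn_gt0.
have pn : (p <= n)%N by rewrite -pqn leq_addr.
have qn : (q <= n)%N by rewrite -pqn leq_addl.
have n0 : (0 < n)%N by exact: leq_trans pn.
have N0 : 0 < n%:R :> R by rewrite ltr0n.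
pose blk i := bad_block p q (minn (2 ^ i.+1) p) (u * 2 ^+ i * n%:R) (u * 2 ^+ i).
pose F i := if (K / D < 2 ^+ i.+1) && (2 ^ i <= p)%N then blk i else set0.
have mF i : measurable (F i).
  by rewrite /F; case: ifP => // _; exact: measurable_bad_block.
pose G s r := [set w | u * n%:R ^+ 2 < nsq e s r w].
have mG s r : measurable (G s r) by apply: measurable_gt; exact: (nsq_L2 eC s r).1.
have un2 : 0 < u * n%:R ^+ 2 by rewrite mulr_gt0// exprn_gt0.
have PG s r : (r <= n)%N -> Pr P (G s r) <= C * m%:R / (u * n%:R).
  move=> rn; apply: (@le_trans _ _ (Ex P (nsq e s r) / (u * n%:R ^+ 2))).
    apply: markov_Pr => //; first exact: (L2_L1 (nsq_L2 eC s r)).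
    by move=> w; apply: sumr_ge0 => k _; exact: sqr_ge0.
  rewrite ler_pdivrMr//; apply: (le_trans (Ex_nsq eC s r)).
  rewrite (_ : _ / _ * _ = C * n%:R * m%:R); last by field; rewrite !gt_eqF.
  by rewrite ler_wpM2r// ler_wpM2l// ler_nat.
exists (\big[setU/set0]_(i < n) F i `|` (G false q `|` G true p)).
have mU : measurable (\big[setU/set0]_(i < n) F i) by exact: bigsetU_measurable.
split.
- by apply: measurableU => //; exact: measurableU.
- apply: (le_trans (PrU P mU (measurableU _ _ (mG false q) (mG true p)))); apply: lerD.
    apply: (le_trans (Pr_bigcup P n mF)).
    pose M := 134 * C ^+ 2 * D / u ^+ 2.
    have M0 : 0 <= M by rewrite /M divr_ge0 ?sqr_ge0// mulr_ge0 ?(ltW D0)// mulr_ge0 ?sqr_ge0.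
    apply: (@le_trans _ _ (\sum_(i < n) M *
      (if K / D < 2 ^+ i.+1 then (2 ^+ i)^-1 else 0))).
      apply: ler_sum => i _; rewrite /F.
      case: (K / D < 2 ^+ i.+1) => /=; last by rewrite mulr0 /Pr measure0.
      case: ifP => ip; last by rewrite /Pr measure0 mulr_ge0// invr_ge0 exprn_ge0.
      exact: Pr_bad_block.
    rewrite -mulr_sumr; apply: (@le_trans _ _ (M * (4 / (K / D)))).
      by apply: ler_wpM2l => //; apply: geometric_tail; exact: divr_gt0.
    rewrite /M le_eqVlt; apply/orP; left; apply/eqP; field.
    by rewrite !gt_eqF.
  apply: (le_trans (PrU P (mG false q) (mG true p))).
  by have := PG false q qn; have := PG true p pn; lra.
move=> w nbad h /andP[h0 hp] Kh cj.
have [i /andP[ih hi]] : exists i, (2 ^ i <= h < 2 ^ i.+1)%N.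
  by exists (trunc_log 2 h); exact: trunc_log_bounds.
have ip : (2 ^ i <= p)%N by rewrite (leq_trans ih)// ltnW.
have iN : (i < n)%N.
  by apply: leq_trans pn; apply: leq_trans ip; exact: ltn_expl.
have KDi : K / D < 2 ^+ i.+1.
  rewrite ltr_pdivrMr//; apply: (lt_trans Kh); rewrite ltr_pM2r//.
  by rewrite -natrX ltr_nat.
have nblk : ~ blk i w.
  move=> bi; apply: nbad; left; rewrite -(bigcup_mkord n F).
  by exists i => //; rewrite /F KDi ip.
have hh0 : 0 < h%:R :> R by rewrite ltr0n.
have ihR : 2 ^+ i <= h%:R :> R by rewrite -natrX ler_nat.
have y0 : 0 <= u * 2 ^+ i * n%:R by rewrite !mulr_ge0// ltW.
have z0 : 0 <= u * 2 ^+ i by rewrite !mulr_ge0// ltW.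
have hH : (h <= minn (2 ^ i.+1) p)%N by rewrite leq_min (ltnW hi) (ltnW hp).
have [e1 e2 e3 e4] := bad_blockPn y0 z0 (geq_minr _ _) hH nblk.
have zh : u * 2 ^+ i <= u * h%:R by rewrite ler_pM2l.
have yh : u * 2 ^+ i * n%:R <= u * h%:R * n%:R by rewrite ler_pM2r.
apply: (@gain_positive _ _ _ _ _ _ n%:R p%:R q%:R h%:R c D u uE c0 c1 D0) => //.
- by rewrite ltr0n.
- by rewrite ler1n.
- by rewrite ltr_nat.
- by rewrite -natrD pqn.
- rewrite leNgt; apply/negP => hG; apply: nbad; right; left; exact: hG.
- rewrite leNgt; apply/negP => hG; apply: nbad; right; right; exact: hG.
- exact: le_trans yh.
- exact: le_trans yh.
- by apply: (le_trans e3); rewrite ler_pM2l.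
- exact: le_trans zh.
Qed.

End one_sided.

(** * From independent observations to the noise family *)

Section grouping.
Context (R : realType) (d : measure_display) (T : measurableType d).
Context (P : probability T R) (J : finType) (S : J -> set (set T)).
Context (S_measurable : forall j, S j `<=` measurable).
Context (S_setI : forall j, setI_closed (S j)).
Context (S_setT : forall j, S j setT).
Context (S_indep : forall E : J -> set T, (forall j, S j (E j)) ->
  P (\bigcap_j E j) = (\prod_j P (E j))%E).

(** The rectangles without constraint on the coordinate [j0] form a pi-system
    that generates the sigma-algebra of the other coordinates; two finite
    measures that agree on it agree on that sigma-algebra. *)
Lemma indep_rest j0 A B : <<s \bigcup_(j in [set~ j0]) S j >> A -> S j0 B ->
  P (A `&` B) = (P A * P B)%E.
Proof.
move=> sA SB.
have mB : measurable B by exact: S_measurable SB.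
pose G := [set A | exists E : J -> set T,
  [/\ forall j, S j (E j), E j0 = setT & A = \bigcap_j E j]].
have Gm : G `<=` measurable.
  move=> _ [E [SE _ ->]]; apply: fin_bigcap_measurable.
    exact: finite_finset.
  by move=> j _; exact: S_measurable (SE j).
have GI : setI_closed G.
  move=> _ _ [E [SE E0 ->]] [E' [SE' E0' ->]].
  exists (fun j => E j `&` E' j); split.
  - by move=> j; exact: S_setI.
  - by rewrite E0 E0' setIT.
  - by rewrite bigcapI.
have GT : G setT.
  exists (fun=> setT); split => //.
  by apply/seteqP; split => // w _ j.
pose r := NngNum (Pr_ge0 P B).
have mG A' : G A' -> mrestr P mB A' = mscale r P A'.
  move=> [E [SE E0 ->]]; rewrite /mrestr /mscale /= -PrE// muleC.
  pose E' j := if j == j0 then B else E j.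
  have -> : \bigcap_j E j `&` B = \bigcap_j E' j.
    apply/seteqP; split => w.
      by move=> [Ew Bw] j _; rewrite /E'; case: eqP => // _; exact: Ew.
    move=> E'w; split.
      move=> j _; have := E'w j I; rewrite /E'; case: eqP => // -> _.
      by rewrite E0.
    by have := E'w j0 I; rewrite /E' eqxx.
  have SE' j : S j (E' j) by rewrite /E'; case: (j =P j0) => // ->.
  rewrite (S_indep SE') (S_indep SE) (bigD1 j0)//= [in RHS](bigD1 j0)//=.
  rewrite {1}/E' eqxx E0 [P setT]probability_setT mul1e muleC; congr (_ * _)%E.
  by apply: eq_bigr => j jj0; rewrite /E' (negbTE jj0).
have GE : forall A', <<s G >> A' -> mrestr P mB A' = mscale r P A'.
  apply: (@g_sigma_algebra_measure_unique _ _ _ G Gm (fun=> setT) (fun=> GT) _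
    (mrestr P mB) (mscale r P) GI mG).
    by rewrite bigcup_const.
  by move=> n; rewrite -ge0_fin_numE// fin_num_measure.
have : <<s G >> A.
  move: A sA; apply: sub_smallest2r; first exact: smallest_sigma_algebra.
  move=> A [j jj0 SA].
  exists (fun i => if i == j then A else setT); split.
  - by move=> i; case: eqP => // ->.
  - by case: eqP => // jE; exfalso; exact: jj0.
  - apply/seteqP; split => w.
      by move=> Aw i _; case: eqP.
    by move=> /(_ j I); rewrite eqxx.
move=> /GE; rewrite /mrestr /mscale/= -PrE// muleC.
by [].
Qed.

End grouping.

Section noise_of_family.
Context (R : realType) (d : measure_display) (T : measurableType d).
Context (P : probability T R) (J : finType) (I : choiceType) (Y : J -> T -> R).
Context (S : J -> set (set T)) (phi : I -> option J) (C : R).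

(** The array of observations is relabelled by side and distance; labels that
    fall outside the sample carry the zero variable, which
    leaves all moment and orthogonality properties true at every label. *)
Definition reindexed (i : I) : T -> R := if phi i is Some j then Y j else fun=> 0.

Lemma reindexed_noise :
  (forall j, S j `<=` measurable) -> (forall j, setI_closed (S j)) ->
  (forall j, S j setT) ->
  (forall E : J -> set T, (forall j, S j (E j)) ->
    P (\bigcap_j E j) = (\prod_j P (E j))%E) ->
  (forall j B, measurable B -> S j (Y j @^-1` B)) ->
  (forall i i' j, phi i = Some j -> phi i' = Some j -> i = i') ->
  1 <= C -> (forall j, L4 P (Y j)) -> (forall j, Ex P (Y j) = 0) ->
  (forall j, Ex P (fun w => Y j w ^+ 4) <= C) ->
  white_noise P reindexed C.
Proof.
move=> Sm SI ST Sind SY phi_inj C1 Y4 Y0 YC; rewrite /reindexed; split => //.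
- by move=> i; case: (phi i) => [j|]; [exact: Y4|exact: L4_cst].
- by move=> i; case: (phi i) => [j|]; [exact: Y0|rewrite Ex_cst].
- move=> i; case: (phi i) => [j|]; first exact: YC.
  by rewrite Ex_cst expr0n/= (le_trans ler01).
move=> i B A mB.
case: (phi i) (phi_inj i) => [j0|] inj.
  move=> sA; apply: (@indep_rest _ _ _ P J S Sm SI ST Sind j0); last exact: SY.
  apply: smallest_sub sA; first exact: smallest_sigma_algebra.
  move=> D [i' i'i [B' mB' <-]]; rewrite setTI.
  case ei' : (phi i') => [j|].
    apply: sub_sigma_algebra; exists j; last exact: SY.
    by move=> /= jj0; apply: i'i; symmetry; apply: inj ei'; rewrite jj0.
  rewrite preimage_cst; case: ifP => _; last exact: sigma_algebra0.
  exact: (@measurableT _ (g_sigma_algebraType (\bigcup_(j in [set~ j0]) S j))).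
move=> sA; rewrite preimage_cst; case: ifP => _.
  by rewrite setIT [P setT]probability_setT mule1.
by rewrite setI0 measure0 mule0.
Qed.

End noise_of_family.

Section rectangles.
Context (R : realType) (d : measure_display) (T : measurableType d).
Context (P : probability T R).

Lemma sigma_rv_le (I : Type) (D D' : set I) (X : I -> T -> R) :
  D `<=` D' -> sigma_rv D X `<=` sigma_rv D' X.
Proof.
move=> DD'; apply: sub_smallest2r; first exact: smallest_sigma_algebra.
by move=> A [i Di iA]; exists i => //; exact: DD'.
Qed.

Lemma sigma_rv_measurable (I : Type) (D : set I) (X : I -> T -> R) :
  (forall i, measurable_fun setT (X i)) -> sigma_rv D X `<=` measurable.
Proof.
move=> mX; apply: (@smallest_sub _ (sigma_algebra setT)).
  exact: sigma_algebra_measurable.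
by move=> A [i Di [B' mB' <-]]; exact: mX.
Qed.

Lemma sigma_rvI (I : Type) (D : set I) (X : I -> T -> R) : setI_closed (sigma_rv D X).
Proof.
exact: (@measurableI _ (g_sigma_algebraType
  (\bigcup_(i in D) preimage_set_system setT (X i) measurable))).
Qed.

Lemma sigma_rvT (I : Type) (D : set I) (X : I -> T -> R) : sigma_rv D X setT.
Proof.
exact: (@measurableT _ (g_sigma_algebraType
  (\bigcup_(i in D) preimage_set_system setT (X i) measurable))).
Qed.

Lemma sigma_rv_bigcap (I : Type) (D : set I) (X : I -> T -> R) (J : choiceType)
    (r : {fset J}) (F : J -> set T) :
  (forall i, i \in r -> sigma_rv D X (F i)) ->
  sigma_rv D X (\bigcap_(i in [set` r]) F i).
Proof.
move=> DF; apply: (@fin_bigcap_measurable _ (g_sigma_algebraType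
  (\bigcup_(i in D) preimage_set_system setT (X i) measurable))) => //.
Qed.

(** Within a series, factor first between the two regimes and then inside each of
    them; then factor over the series. *)
Lemma rectangle_prob (m n s : nat) (X : 'I_m -> nat -> T -> R) (pre post : set nat) :
  (s <= n)%N ->
  pre = [set t | (1 <= t <= s)%N] -> post = [set t | (s < t <= n)%N] ->
  independent_classes P [set: 'I_m] (fun k => sigma_rv (times n) (X k)) ->
  (forall k, independent_rvs P pre (X k)) ->
  (forall k, independent_rvs P post (X k)) ->
  (forall k, independent_pair P (sigma_rv pre (X k)) (sigma_rv post (X k))) ->
  forall E : 'I_m * 'I_n -> set T,
  (forall j : 'I_m * 'I_n, sigma_rv [set (j.2 : nat).+1] (X j.1) (E j)) ->
  P (\bigcap_j E j) = (\prod_j P (E j))%E.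
Proof.
move=> sn preE postE hseries hpre hpost hpp E SE.
pose Ek k t := oapp (fun a : 'I_n => E (k, a)) setT (insub t.-1).
have EkS k (a : 'I_n) : Ek k a.+1 = E (k, a) by rewrite /Ek /= valK.
have SEk k t : (0 < t)%N -> sigma_rv [set t] (X k) (Ek k t).
  case: t => // t _; rewrite /Ek/=; case: insubP => [a _ <-|_] /=.
    exact: (SE (k, a)).
  exact: sigma_rvT.
pose Jp : {fset nat} := [fset t in iota 1 s]%fset.
pose Jq : {fset nat} := [fset t in iota s.+1 (n - s)]%fset.
have inJp t : (t \in Jp) = (1 <= t <= s)%N.
  by rewrite in_fset /= mem_iota add1n ltnS.
have inJq t : (t \in Jq) = (s < t <= n)%N.
  by rewrite in_fset /= mem_iota addSn subnKC// ltnS.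
pose Fp k := \bigcap_(t in [set` Jp]) Ek k t.
pose Fq k := \bigcap_(t in [set` Jq]) Ek k t.
have SFp k : sigma_rv pre (X k) (Fp k).
  apply: sigma_rv_bigcap => t; rewrite inJp => /andP[t1 ts].
  apply: sigma_rv_le (SEk k t t1) => _ ->.
  by rewrite preE /= t1.
have SFq k : sigma_rv post (X k) (Fq k).
  apply: sigma_rv_bigcap => t; rewrite inJq => /andP[t1 ts].
  apply: sigma_rv_le (SEk k t (leq_ltn_trans _ t1)) => // _ ->.
  by rewrite postE /= t1.
have Pk k : (P (Fp k `&` Fq k) = \prod_(a < n) P (E (k, a)))%E.
  rewrite (hpp k _ _ (SFp k) (SFq k)) (hpre k Jp (Ek k)); last 2 first.
  - by move=> t /=; rewrite inJp preE.
  - by move=> t; rewrite inJp => /andP[t1 _]; exact: SEk.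
  rewrite (hpost k Jq (Ek k)); last 2 first.
  - by move=> t /=; rewrite inJq postE.
  - by move=> t; rewrite inJq => /andP[t1 _]; apply: SEk; exact: leq_ltn_trans t1.
  rewrite -big_cat/=.
  have /(perm_big _) -> : perm_eq (Jp ++ Jq) [seq (a : 'I_n).+1 | a <- enum 'I_n].
    apply: uniq_perm.
    - rewrite cat_uniq !fset_uniq/= andbT; apply/hasPn => t.
      by rewrite /= inJq inJp; lia.
    - by rewrite map_inj_uniq ?enum_uniq// => a b [] /ord_inj.
    - move=> t; rewrite mem_cat inJp inJq; apply/idP/mapP.
        move=> h; have tn : (t.-1 < n)%N by lia.
        by exists (Ordinal tn); [rewrite mem_enum|rewrite /=; lia].
      by move=> [a _ ->]; have := ltn_ord a; lia.
  by rewrite big_map big_enum/=; apply: eq_bigr => a _; rewrite EkS.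
have times_le D k : D `<=` times n -> sigma_rv D (X k) `<=` sigma_rv (times n) (X k).
  exact: sigma_rv_le.
pose K : {fset 'I_m} := [fset k in enum 'I_m]%fset.
have inK k : k \in K by rewrite in_fset /= mem_enum.
have -> : \bigcap_j E j = \bigcap_(k in [set` K]) (Fp k `&` Fq k).
  apply/seteqP; split => w.
    move=> Ew k _; split => t /=.
      rewrite inJp; case: t => // t ts; have tn : (t < n)%N by lia.
      by rewrite (_ : t = Ordinal tn)// EkS; exact: Ew.
    rewrite inJq; case: t => // t ts; have tn : (t < n)%N by lia.
    by rewrite (_ : t = Ordinal tn)// EkS; exact: Ew.
  move=> Fw [k a] _; have [Fpw Fqw] := Fw k (inK k).
  rewrite -EkS; have := ltn_ord a; case: (leqP a.+1 s) => as_ an.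
    by apply: Fpw; rewrite /= inJp.
  by apply: Fqw; rewrite /= inJq as_.
rewrite hseries => //; last first.
  move=> k _; apply: sigma_rvI.
    by apply: (times_le _ k _ _ (SFp k)) => t; rewrite preE /times /=; lia.
  by apply: (times_le _ k _ _ (SFq k)) => t; rewrite postE /times /=; lia.
have /(perm_big _) -> : perm_eq K (enum 'I_m).
  by apply: uniq_perm => [||k]; rewrite ?fset_uniq ?enum_uniq ?mem_enum ?inK.
rewrite big_enum/=; under eq_bigr do rewrite Pk.
by rewrite pair_big/=; apply: eq_bigr => -[].
Qed.

End rectangles.

(** * The least squares criterion in terms of one-sided sums *)

Section criterion.
Context (R : realType).

Lemma sum_sqr_dev (x : nat -> R) (a b : nat) : (a < b)%N ->
  \sum_(a <= t < b) (x t - (b - a)%:R^-1 * \sum_(a <= t < b) x t) ^+ 2 =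
  \sum_(a <= t < b) x t ^+ 2 - (\sum_(a <= t < b) x t) ^+ 2 / (b - a)%:R.
Proof.
move=> ab; set S := \sum_(a <= t < b) x t; set M := (b - a)%:R^-1 * S.
have ba0 : (b - a)%:R != 0 :> R by rewrite pnatr_eq0 subn_eq0 -ltnNge.
have -> : \sum_(a <= t < b) (x t - M) ^+ 2 =
    \sum_(a <= t < b) x t ^+ 2 - 2 * M * S + M ^+ 2 * (b - a)%:R.
  rewrite mulr_natr -sumr_const_nat /S; clearbody M.
  rewrite mulr_sumr -sumrB -big_split; apply: eq_bigr => t _ /=; ring.
by rewrite /M; field.
Qed.

Lemma lse_criterionE (n m j : nat) (x : 'I_m -> nat -> R) : (0 < j < n)%N ->
  lse_criterion n x (j%:R / n%:R) =
  - (n%:R^-1 * \sum_(k < m) (\sum_(1 <= t < n.+1) x k t ^+ 2 -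
      ((\sum_(1 <= t < j.+1) x k t) ^+ 2 / j%:R +
       (\sum_(j.+1 <= t < n.+1) x k t) ^+ 2 / (n - j)%:R))).
Proof.
move=> /andP[j0 jn]; have n0 : n%:R != 0 :> R by rewrite pnatr_eq0 -lt0n (ltn_trans j0).
have nj : n%:R * (j%:R / n%:R) = j%:R :> R by field.
have nj' : n%:R * (1 - j%:R / n%:R) = (n - j)%:R :> R by rewrite natrB ?(ltnW jn)//; field.
rewrite /lse_criterion /muhat1 /muhat2 /split_time nj nj' natrK.
congr (- (_ * _)); apply: eq_bigr => k _.
have := @sum_sqr_dev (x k) 1 j.+1 j0; rewrite subSS subn0 => ->.
have := @sum_sqr_dev (x k) j.+1 n.+1 jn; rewrite subSS => ->.
rewrite (@big_cat_nat _ _ _ j.+1 1 n.+1)//=; last by rewrite ltnS ltnW.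
ring.
Qed.

Context (n s : nat).

(** Observation times by distance from the change: [o = true] is the side before
    it, numbered backwards from [s], and [o = false] the side after it, numbered
    forwards from [s + 1].  This makes the two sides interchangeable. *)
Definition side_time (o : bool) (i : nat) : nat := if o then (s - i)%N else (s + i).+1.
Definition side_len (o : bool) : nat := if o then s else (n - s)%N.
Definition side_sum (x : nat -> R) (o : bool) (h : nat) : R :=
  \sum_(i < h) x (side_time o i).

Lemma side_sum_before x h : (h <= s)%N ->
  side_sum x true h = \sum_((s - h).+1 <= t < s.+1) x t.
Proof.
elim: h => [|h IH] hs; first by rewrite /side_sum big_ord0 subn0 big_geq.
rewrite /side_sum big_ord_recr/= -/(side_sum x true h) IH ?(ltnW hs)//.
rewrite (_ : (s - h.+1).+1 = s - h)%N; last by lia.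
by rewrite [RHS]big_ltn ?ltnS ?leq_subr// addrC.
Qed.

Lemma side_sum_after x h : side_sum x false h = \sum_(s.+1 <= t < s.+1 + h) x t.
Proof.
elim: h => [|h IH].
  by rewrite /side_sum big_ord0 addn0 big_geq.
rewrite /side_sum big_ord_recr/= -/(side_sum x false h) IH.
by rewrite addnS [RHS]big_nat_recr ?leq_addr.
Qed.

Definition side_split (o : bool) (h : nat) : nat := if o then (s - h)%N else (s + h)%N.

Context (s0 : (0 < s)%N).
Context (sn : (s < n)%N).

Lemma side_split_bounds o h : (h < side_len o)%N -> (0 < side_split o h < n)%N.
Proof. by rewrite /side_split /side_len; case: o; lia. Qed.

(** The term [\sum_t x_t^2] is common to all splits, so only the squared block
    sums over the block lengths matter.  For [h = 0] this is the split at the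
    change itself. *)
Lemma lse_criterion_side (m : nat) (x : 'I_m -> nat -> R) o h : (h < side_len o)%N ->
  lse_criterion n x ((side_split o h)%:R / n%:R) =
  - (n%:R^-1 * \sum_(k < m) (\sum_(1 <= t < n.+1) x k t ^+ 2 -
      ((side_sum (x k) o (side_len o) - side_sum (x k) o h) ^+ 2
          / ((side_len o)%:R - h%:R) +
       (side_sum (x k) (~~ o) (side_len (~~ o)) + side_sum (x k) o h) ^+ 2
          / ((side_len (~~ o))%:R + h%:R)))).
Proof.
move=> hl; rewrite lse_criterionE ?side_split_bounds//.
congr (- (_ * _)); apply: eq_bigr => k _; congr (_ - _).
move: hl; rewrite /side_split /side_len; case: o => hl /=.
  rewrite !side_sum_before ?(ltnW hl)// side_sum_after subnn.
  rewrite -natrB ?(ltnW hl)// -natrD.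
  rewrite (_ : n - (s - h) = n - s + h)%N; last by lia.
  rewrite (_ : s.+1 + (n - s) = n.+1)%N; last by lia.
  rewrite (@big_cat_nat _ _ _ (s - h).+1 1 s.+1)//= ?addrK; last by lia.
  rewrite (@big_cat_nat _ _ _ s.+1 (s - h).+1 n.+1)//=; [|by lia|by lia].
  by rewrite [X in (X ^+ 2 / (n - s + h)%:R)]addrC.
rewrite !side_sum_after side_sum_before// subnn.
rewrite -natrB ?(ltnW hl)// -natrD addrC.
rewrite (_ : n - (s + h) = n - s - h)%N; last by lia.
rewrite (_ : s.+1 + (n - s) = n.+1)%N; last by lia.
rewrite -addSn.
rewrite (@big_cat_nat _ _ _ s.+1 1 (s.+1 + h))//=; last by lia.
rewrite (@big_cat_nat _ _ _ (s.+1 + h) s.+1 n.+1)//=; [|by lia|by lia].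
by rewrite [X in _ = X ^+ 2 / _ + _]addrAC subrr add0r addrC.
Qed.

End criterion.

(** * The probability bound at a fixed sample size *)

Section side_noise.
Context (R : realType) (d : measure_display) (T : measurableType d).
Context (P : probability T R) (n s m : nat).
Context (x : 'I_m -> nat -> T -> R) (mu : bool -> 'I_m -> R).

Definition centred (j : 'I_m * 'I_n) (w : T) : R :=
  x j.1 (j.2 : nat).+1 w - mu ((j.2 : nat).+1 <= s)%N j.1.

Definition side_index (o : bool) (i : nat) : option 'I_n :=
  if o then (if (i < s)%N then insub (s - i.+1)%N else None) else insub (s + i)%N.

(** Seen from the side [o] of the candidate, the label [true] denotes the side [o]
    and the label [false] the opposite one. *)
Definition oriented (o : bool) (i : 'I_m * (bool * nat)) : option ('I_m * 'I_n) :=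
  omap (pair i.1) (side_index (i.2.1 == o) i.2.2).

Lemma oriented_inj o i i' j : oriented o i = Some j -> oriented o i' = Some j -> i = i'.
Proof.
case: i i' => [k [b a]] [k' [b' a']]; rewrite /oriented /=.
case e1 : side_index => [c|]//= [<-]; case e2 : side_index => [c'|]//= [kk' cc'].
subst k' c'.
have sideE o' z (u : 'I_n) : side_index o' z = Some u ->
    if o' then (z < s)%N /\ u = (s - z.+1)%N :> nat else u = (s + z)%N :> nat.
  rewrite /side_index; case: o'; first case: ifP => // zs.
    by case: insubP => //= v _ <- [->].
  by case: insubP => //= v _ <- [->].
have := sideE _ _ _ e1; have := sideE _ _ _ e2.
case: (b =P o) => [->|/eqP bo]; case: (b' =P o) => [->|/eqP b'o] /=.
- by move=> [h1 h2] [h3 h4]; congr (_, (_, _)); lia.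
- by move=> h2 [h3 h4]; lia.
- by move=> [h1 h2] h4; lia.
- move=> h1 h2; congr (_, (_, _)); last by lia.
  by case: b b' o bo b'o {e1 e2} => [] [] [].
Qed.

Context (sn : (s < n)%N).

Let noise o := reindexed centred (oriented o).

Lemma nsum_side o b k h w : (h <= side_len n s (b == o))%N ->
  nsum (noise o) b k h w =
  side_sum s (fun t => x k t w) (b == o) h - h%:R * mu (b == o) k.
Proof.
move=> hl; rewrite -[h in h%:R]card_ord mulr_natl -sumr_const /side_sum -sumrB.
apply: eq_bigr => i _; have ih := ltn_ord i.
rewrite /noise /reindexed /oriented /= /side_index /side_time.
move: hl; rewrite /side_len; case: (b == o) => hl.
  have is_ : (i < s)%N by exact: leq_trans ih hl.
  rewrite is_; case: insubP => [u _ uE|]; last by move=> h'; exfalso; lia.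
  rewrite /= /centred /= uE; have -> : (s - i.+1).+1 = (s - i)%N by lia.
  by rewrite leq_subr.
case: insubP => [u _ uE|]; last by move=> h'; exfalso; lia.
rewrite /= /centred /= uE; have -> : ((s + i).+1 <= s)%N = false by lia.
by [].
Qed.

(** The criteria at [h] and at [0] differ by [h / n] times the gain of
    [split_gain]. *)
Lemma lse_prefers_change (w : T) o h : (0 < s)%N -> (0 < h < side_len n s o)%N ->
  let p : R := (side_len n s o)%:R in let q : R := (side_len n s (~~ o))%:R in
  let A k := nsum (noise o) true k h w in
  let Q k := nsum (noise o) true k (side_len n s o) w in
  let B k := nsum (noise o) false k (side_len n s (~~ o)) w in
  0 < \sum_k (q / (q + h%:R) * (mu o k - mu (~~ o) k + A k / h%:R - B k / q) ^+ 2
       - (p - h%:R) / p * ((Q k - A k) / (p - h%:R) - A k / h%:R) ^+ 2) ->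
  lse_criterion n (fun k t => x k t w) ((side_split s o h)%:R / n%:R) <
  lse_criterion n (fun k t => x k t w) (s%:R / n%:R).
Proof.
move=> s0 /andP[h0 hp] p q A Q B gain.
have n0 : 0 < n%:R :> R by rewrite ltr0n (ltn_trans s0).
have l0 : (0 < side_len n s o)%N by exact: ltn_trans hp.
have q0 : (0 < side_len n s (~~ o))%N by rewrite /side_len; case: (~~ o); lia.
have hs : side_split s o 0 = s by rewrite /side_split subn0 addn0; case: o {p q A Q B gain hp l0 q0}.
rewrite -{2}hs !lse_criterion_side//.
rewrite ltrN2 ltr_pM2l ?invr_gt0// -subr_gt0 -sumrB.
have tE : (true == o) = o by case: (o).
have fE : (false == o) = ~~ o by case: (o).
have hR : 0 < h%:R :> R by rewrite ltr0n.
have pR : h%:R < p by rewrite ltr_nat.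
have qR : 0 < q by rewrite ltr0n.
suff -> : \sum_(i < m) (\sum_(1 <= t < n.+1) x i t w ^+ 2 -
     ((side_sum s (x i ^~ w) o (side_len n s o) - side_sum s (x i ^~ w) o h) ^+ 2
        / (p - h%:R) +
      (side_sum s (x i ^~ w) (~~ o) (side_len n s (~~ o)) + side_sum s (x i ^~ w) o h) ^+ 2
        / (q + h%:R)) -
     (\sum_(1 <= t < n.+1) x i t w ^+ 2 -
      ((side_sum s (x i ^~ w) o (side_len n s o) - side_sum s (x i ^~ w) o 0) ^+ 2
         / (p - 0%:R) +
       (side_sum s (x i ^~ w) (~~ o) (side_len n s (~~ o)) + side_sum s (x i ^~ w) o 0) ^+ 2
         / (q + 0%:R)))) =
   h%:R * \sum_k (q / (q + h%:R) * (mu o k - mu (~~ o) k + A k / h%:R - B k / q) ^+ 2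
       - (p - h%:R) / p * ((Q k - A k) / (p - h%:R) - A k / h%:R) ^+ 2).
  by rewrite mulr_gt0.
rewrite mulr_sumr; apply: eq_bigr => k _.
rewrite -split_gain//.
have -> : A k = side_sum s (x k ^~ w) o h - h%:R * mu o k.
  by rewrite /A nsum_side tE// ltnW.
have -> : Q k = side_sum s (x k ^~ w) o (side_len n s o) - p * mu o k.
  by rewrite /Q nsum_side tE.
have -> : B k = side_sum s (x k ^~ w) (~~ o) (side_len n s (~~ o)) - q * mu (~~ o) k.
  by rewrite /B nsum_side fE.
have -> : side_sum s (x k ^~ w) o 0 = 0 by rewrite /side_sum big_ord0.
rewrite !subr0 !addr0.
set X1 := side_sum s _ o h; set X2 := side_sum s _ o _; set X3 := side_sum s _ _ _.
rewrite (_ : (p - h%:R) * mu o k + _ = X2 - X1); last by ring.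
rewrite (_ : h%:R * mu o k + (X1 - _) = X1); last by ring.
rewrite (_ : q * mu (~~ o) k + _ = X3); last by ring.
rewrite subrK [X1 + X3]addrC.
by rewrite [X in _ + X]opprD opprK addrACA subrr add0r addrC.
Qed.

End side_noise.

Section fixed_sample.
Context (R : realType) (d : measure_display) (T : measurableType d).
Context (P : probability T R).

(** An estimator at distance more than [K / (n D)] from the change would be a
    candidate at distance [h > K / D] in time on one of the sides, where the
    criterion is smaller than at the change outside the bad event of that
    side.  The factor 2 counts the sides. *)
Lemma fixed_sample (n m s : nat) (x : 'I_m -> nat -> {RV P >-> R})
    (mu1 mu2 : 'rV[R]_m) (c C K : R) (tauhat : {RV P >-> R}) :
  let tau := s%:R / n%:R in
  let D := norm2 (mu1 - mu2) ^+ 2 in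
  let u := c ^+ 3 * D / 64 in
  0 < c -> (1 <= s <= n)%N -> c < tau < 1 - c ->
  independent_classes P [set: 'I_m]
    (fun k => sigma_rv (times n) (fun t => x k t : T -> R)) ->
  (forall k, iid (pre_times n tau) (x k)) ->
  (forall k, iid (post_times n tau) (x k)) ->
  (forall k, independent_pair P
     (sigma_rv (pre_times n tau) (fun t => x k t : T -> R))
     (sigma_rv (post_times n tau) (fun t => x k t : T -> R))) ->
  (forall k t, times n t -> ('E_P[x k t] =
     (if t%:R <= n%:R * tau then mu1 0 k else mu2 0 k)%:E)%E) ->
  (forall w, is_lse n c (fun k t => x k t w) (tauhat w)) ->
  1 <= C ->
  (forall k t, times n t ->
    ('E_P[fun w => ((x k t w - fine 'E_P[x k t]) ^+ 4)%R] <= C%:E)%E) ->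
  0 < D -> 0 < K -> m%:R <= n%:R * D -> 4 * C * m%:R <= u * n%:R ->
  (P [set w | (K < `|n%:R * D * (tauhat w - tau)|)%R] <=
   (2 * (536 * C ^+ 2 * D ^+ 2 / (u ^+ 2 * K) + 2 * (C * m%:R / (u * n%:R))))%:E)%E.
Proof.
move=> tau D u c0 /andP[s0 sn'] /andP[ctau tauc] hseries hpre hpost hpp hmean hlse C1 h4
  D0 K0 mD Cm.
have n0 : (0 < n)%N by exact: leq_trans sn'.
have N0 : 0 < n%:R :> R by rewrite ltr0n.
have tauE : n%:R * tau = s%:R by rewrite /tau; field; rewrite gt_eqF.
have cs : c * n%:R < s%:R by rewrite -tauE mulrC ltr_pM2l.
have sc : s%:R < (1 - c) * n%:R by rewrite -tauE mulrC ltr_pM2r.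
have sn : (s < n)%N.
  rewrite -(ltr_nat R); apply: (lt_le_trans sc).
  by rewrite ler_piMl// lerBlDr lerDl ltW.
have c1 : c <= 1 by have := lt_trans ctau tauc; lra.
have preE : pre_times n tau = [set t | (1 <= t <= s)%N].
  apply/seteqP; split=> t; rewrite /pre_times /times /= tauE ler_nat.
    by move=> [/andP[-> _] ->].
  by move=> /andP[-> ts]; rewrite ts (leq_trans ts (ltnW sn)).
have postE : post_times n tau = [set t | (s < t <= n)%N].
  apply/seteqP; split=> t; rewrite /post_times /times /= tauE ltr_nat.
    by move=> [/andP[_ ->] ->].
  by move=> /andP[ts tn]; rewrite ts tn (leq_ltn_trans _ ts).
pose mu (o : bool) k := if o then mu1 0 k else mu2 0 k.
pose xx (k : 'I_m) (t : nat) : T -> R := x k t.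
have rect := rectangle_prob (ltnW sn) preE postE hseries (fun k => (hpre k).1)
  (fun k => (hpost k).1) hpp.
pose S (j : 'I_m * 'I_n) := sigma_rv [set (j.2 : nat).+1] (xx j.1).
pose Y := centred (n := n) s xx mu.
have tn (j : 'I_m * 'I_n) : times n (j.2 : nat).+1 by rewrite /times /= ltn_ord.
have meanE (j : 'I_m * 'I_n) : ('E_P[x j.1 (j.2 : nat).+1] =
    (mu ((j.2 : nat).+1 <= s)%N j.1)%:E)%E.
  by rewrite hmean// tauE ler_nat /mu; case: ifP.
have mY j : measurable_fun setT (Y j).
  by apply: measurable_funB => //; exact: measurable_funP.
have Y4E (j : 'I_m * 'I_n) : (\int[P]_w ((Y j w) ^+ 4)%:E <= C%:E)%E.
  by have := h4 j.1 _ (tn j); rewrite meanE unlock.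
have Y4 j : L4 P (Y j).
  split => //; apply/integrableP; split.
    by apply/measurable_EFinP; exact: measurable_funX.
  apply: le_lt_trans (ltry C); apply: le_trans (Y4E j).
  rewrite le_eqVlt; apply/orP; left; apply/eqP; apply: eq_integral => w _ /=.
  by rewrite ger0_norm// exprn_even_ge0.
have Y0 j : Ex P (Y j) = 0.
  have Y1 := L2_L1 (L4_L2 (Y4 j)).
  have xE : (x j.1 (j.2 : nat).+1 : T -> R) =
      (fun w => Y j w + mu ((j.2 : nat).+1 <= s)%N j.1).
    by apply/funext => w; rewrite /Y /centred /xx subrK.
  have : Ex P (x j.1 (j.2 : nat).+1) = mu ((j.2 : nat).+1 <= s)%N j.1.
    by rewrite /Ex /Rintegral; have := meanE j; rewrite unlock => ->.
  rewrite xE ExD ?Ex_cst//; last exact: L1_cst.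
  by move=> /eqP; rewrite -subr_eq0 addrK => /eqP.
have YC j : Ex P (fun w => Y j w ^+ 4) <= C.
  rewrite -lee_fin /Ex /Rintegral fineK//.
  exact: integrable_fin_num (Y4 j).2.
have SY j B : measurable B -> S j (Y j @^-1` B).
  move=> mB; apply: sub_sigma_algebra; exists (j.2 : nat).+1 => //.
  exists ((fun r : R => r - mu ((j.2 : nat).+1 <= s)%N j.1) @^-1` B); last first.
    by rewrite setTI.
  have mf : measurable_fun setT (fun r : R => r - mu ((j.2 : nat).+1 <= s)%N j.1).
    exact: measurable_funB.
  by have := mf measurableT _ mB; rewrite setTI.
have eC o : white_noise P (reindexed Y (oriented n s o)) C.
  apply: (@reindexed_noise _ _ _ P _ _ Y S) => //.
  - by move=> j; apply: sigma_rv_measurable => t; exact: measurable_funP.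
  - by move=> j; exact: sigma_rvI.
  - by move=> j; exact: sigma_rvT.
  - exact: oriented_inj.
have DE o : D = \sum_k (mu o k - mu (~~ o) k) ^+ 2.
  rewrite /D /norm2 sqr_sqrtr; last by apply: sumr_ge0 => k _; exact: sqr_ge0.
  apply: eq_bigr => k _; rewrite !mxE /mu; case: o => //=.
  by rewrite -sqrrN opprB.
have uE : 64 * u = c ^+ 3 * D by rewrite /u; field.
have len0 o : (0 < side_len n s o)%N by rewrite /side_len; case: o; clear -s0 sn; lia.
have lenn o : (side_len n s o + side_len n s (~~ o) = n)%N.
  by rewrite /side_len; case: o => /=; clear -sn; lia.
have clen o : c * n%:R <= (side_len n s o)%:R.
  rewrite /side_len; case: o; first exact: ltW.
  by rewrite natrB ?(ltnW sn)//; clear -sc; lra.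
have bad o := one_sided (eC o) (DE o) (lenn o) (len0 o) (len0 (~~ o)) c0 c1
  (clen (~~ o)) D0 K0 uE mD Cm.
have [B hB] := choice bad.
have [mBt PBt _] := hB true; have [mBf PBf _] := hB false.
have mE : measurable [set w | K < `|n%:R * D * (tauhat w - tau)|].
  apply: measurable_gt; apply: measurableT_comp => //.
  by apply: measurable_funM => //; exact: measurable_funB.
rewrite PrE// lee_fin [leRHS]mulr_natl mulr2n.
apply: le_trans (lerD PBt PBf); apply: le_trans (PrU P mBt mBf).
apply: Pr_le => //; first exact: measurableU.
move=> w /= Kw; apply: contrapT => /not_orP[nBt nBf].
have [[[j /andP[j1 jn] jE] /andP[cj jc]] best] := hlse w.
have nj : n%:R * (tauhat w) = j%:R by rewrite jE; field; rewrite gt_eqF.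
have {}cj : c * n%:R < j%:R by rewrite -nj mulrC ltr_pM2l.
have {}jc : j%:R < (1 - c) * n%:R by rewrite -nj mulrC ltr_pM2r.
have better : lse_criterion n (fun k t => x k t w) (s%:R / n%:R) <=
    lse_criterion n (fun k t => x k t w) (j%:R / n%:R).
  rewrite -jE; apply: best; split; last by rewrite /= -/tau ctau.
  by exists s => //; rewrite s0 ltnW.
have {}Kw : K < `|j%:R - s%:R| * D.
  move: Kw; rewrite (_ : n%:R * D * _ = (j%:R - s%:R) * D); last by rewrite -nj -tauE; ring.
  by rewrite normrM (gtr0_norm D0).
have contra o h : ~ B o w -> (0 < h < side_len n s o)%N -> j = side_split s o h ->
    K < h%:R * D -> c * n%:R <= (side_len n s o)%:R - h%:R -> False.
  move=> nB hh jh Kh ch; have [_ _ gain] := hB o.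
  have := lse_prefers_change sn s0 hh (gain w nB h hh Kh ch).
  by rewrite -jh ltNge better.
case: (ltngtP j s) => [js|sj|js].
- apply: (contra true (s - j)%N nBt); rewrite /side_len /side_split.
  + by clear -j1 js; lia.
  + by clear -js; lia.
  + by move: Kw; rewrite natrB ?(ltnW js)// distrC ger0_norm// subr_ge0 ler_nat ltnW.
  + by rewrite natrB ?(ltnW js)//; clear -cj; lra.
- have jn' : (j < n)%N.
    by rewrite -(ltr_nat R); apply: (lt_trans jc); rewrite gtr_pMl//; clear -c0; lra.
  apply: (contra false (j - s)%N nBf); rewrite /side_len /side_split.
  + by clear -jn' sj; lia.
  + by clear -sj; lia.
  + by move: Kw; rewrite natrB ?(ltnW sj)// ger0_norm// subr_ge0 ler_nat ltnW.
  + by rewrite !natrB ?(ltnW sj) ?(ltnW sn)//; clear -jc; lra.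
- by move: Kw; rewrite js subrr normr0 mul0r ltNge ltW.
Qed.

End fixed_sample.

(** * Consistency rate of the least squares estimator *)

(** With [u = c^3 D / 64], this value of [K] makes the first term of the
    probability bound equal to [eps / 2]. *)
Definition tail_constant (R : realType) (c C eps : R) : R :=
  4 * 536 * 64 ^+ 2 * C ^+ 2 / (c ^+ 6 * eps).

(** The three terms ensure in turn [m <= n D], the room around the mean in
    [nsq_maximal], and that the term in [m / (n D)] is at most [eps / 2]. *)
Definition snr_threshold (R : realType) (c C eps : R) : R :=
  1 + 256 * (C / c ^+ 3) + 512 * (C / (c ^+ 3 * eps)).

Lemma tail_constant_gt0 (R : realType) (c C eps : R) :
  0 < c -> 0 < C -> 0 < eps -> 0 < tail_constant c C eps.
Proof.
move=> c0 C0 e0; rewrite /tail_constant.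
have [Q [Q0 ->]] : exists Q : R, 0 < Q /\ 4 * 536 * 64 ^+ 2 = Q.
  by exists (4 * 536 * 64 ^+ 2); split; [lra|].
by rewrite divr_gt0 ?mulr_gt0 ?exprn_gt0.
Qed.

Lemma bound_le_eps (R : realType) (c C eps D M N : R) :
  let u := c ^+ 3 * D / 64 in
  0 < c -> 0 < C -> 0 < eps -> 0 < D -> 0 < M -> 0 < N ->
  snr_threshold c C eps * M <= N * D ->
  [/\ M <= N * D, 4 * C * M <= u * N &
   2 * (536 * C ^+ 2 * D ^+ 2 / (u ^+ 2 * tail_constant c C eps)
        + 2 * (C * M / (u * N))) <= eps].
Proof.
move=> u c0 C0 e0 D0 M0 N0; rewrite /snr_threshold.
have c30 : 0 < c ^+ 3 by rewrite exprn_gt0.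
have [a aE] : exists a, a = C / c ^+ 3 by eexists.
have [b bE] : exists b, b = C / (c ^+ 3 * eps) by eexists.
have a0 : 0 < a by rewrite aE divr_gt0.
have b0 : 0 < b by rewrite bE divr_gt0 ?mulr_gt0.
have aM := mulr_gt0 a0 M0; have bM := mulr_gt0 b0 M0.
have ND := mulr_gt0 N0 D0.
rewrite -aE -bE => hND.
have h1 : M <= N * D by lra.
have h2 : 256 * (a * M) <= N * D by lra.
have h3 : 512 * (b * M) <= N * D by lra.
have ac : c ^+ 3 * (256 * (a * M)) = 256 * C * M.
  by rewrite aE; field; rewrite gt_eqF.
have bc : c ^+ 3 * eps * (512 * (b * M)) = 512 * C * M.
  by rewrite bE; field; rewrite !gt_eqF.
have u0 : 0 < u by rewrite /u divr_gt0 ?ltr0n ?mulr_gt0.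
have uN : 64 * (u * N) = c ^+ 3 * (N * D) by rewrite /u; field.
have h4 : 4 * C * M <= u * N.
  by have := ler_wpM2l (ltW c30) h2; rewrite ac; lra.
split => //.
have -> : 536 * C ^+ 2 * D ^+ 2 / (u ^+ 2 * tail_constant c C eps) = eps / 4.
  by rewrite /u /tail_constant; field; rewrite !gt_eqF.
have h5 : C * M / (u * N) <= eps / 8.
  rewrite ler_pdivrMr ?mulr_gt0//.
  have := ler_wpM2l (ltW (mulr_gt0 c30 e0)) h3; rewrite bc; nra.
lra.
Qed.

Theorem theorem2p1 (R : realType)
  (d : nat -> measure_display) (T : forall n, measurableType (d n))
  (P : forall n, probability (T n) R)
  (n0 : nat) (m : nat -> nat)
  (X : forall n, 'I_(m n) -> nat -> {RV (P n) >-> R})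
  (c : R) (tau : nat -> R)
  (mu1 mu2 : forall n, 'rV[R]_(m n))
  (tauhat : forall n, {RV (P n) >-> R})
  (hc : 0 < c)
  (htau : forall n, (n0 <= n)%N -> time_grid n (tau n) /\ c < tau n < 1 - c)
  (hseries : forall n, (n0 <= n)%N ->
     independent_classes (P n) [set: 'I_(m n)]
       (fun k => sigma_rv (times n) (fun t => X n k t : T n -> R)))
  (hpre : forall n, (n0 <= n)%N -> forall k,
     iid (pre_times n (tau n)) (X n k))
  (hpost : forall n, (n0 <= n)%N -> forall k,
     iid (post_times n (tau n)) (X n k))
  (hprepost : forall n, (n0 <= n)%N -> forall k,
     independent_pair (P n)
       (sigma_rv (pre_times n (tau n)) (fun t => X n k t : T n -> R))
       (sigma_rv (post_times n (tau n)) (fun t => X n k t : T n -> R)))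
  (hmean : forall n, (n0 <= n)%N -> forall k t, times n t ->
     ('E_(P n)[X n k t] =
      (if t%:R <= n%:R * tau n then mu1 n 0 k else mu2 n 0 k)%:E)%E)
  (hmu : forall n, (n0 <= n)%N -> exists k, mu1 n 0 k != mu2 n 0 k)
  (hlse : forall n, (n0 <= n)%N -> forall w : T n,
     is_lse n c (fun k t => X n k t w) (tauhat n w))
  (A1 : (ereal_sup [set e : \bar R | exists n (k : 'I_(m n)) t,
     [/\ (n0 <= n)%N, times n t &
         e = 'E_(P n)[fun w => ((X n k t w - fine 'E_(P n)[X n k t]) ^+ 4)%R]]]
     < +oo)%E)
  (SNR1 : (fun n => n%:R * (m n)%:R^-1 * norm2 (mu1 n - mu2 n) ^+ 2) @ \oo
     --> +oo) :
  bounded_in_probability P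
    (fun n w => n%:R * norm2 (mu1 n - mu2 n) ^+ 2 * (tauhat n w - tau n)).
Proof.
have [C [C1 hC]] : exists C : R, 1 <= C /\ forall n (k : 'I_(m n)) t, (n0 <= n)%N ->
    times n t ->
    ('E_(P n)[fun w => ((X n k t w - fine 'E_(P n)[X n k t]) ^+ 4)%R] <= C%:E)%E.
  move: A1; set S := ereal_sup _ => Sy.
  exists (Num.max 1 (fine S)); split; first by rewrite le_max lexx.
  move=> n k t nn0 ht; apply: (@le_trans _ _ S).
    by apply: ereal_sup_ubound; exists n, k, t.
  case: S Sy => [r _| //|_]; last by rewrite leNye.
  by rewrite lee_fin le_max /= lexx orbT.
move=> eps eps0.
have C0 : 0 < C by exact: lt_le_trans C1.
pose K := tail_constant c C eps.
have K0 : 0 < K by exact: tail_constant_gt0.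
exists K.
have /cvgryPge/(_ (snr_threshold c C eps)) hA := SNR1.
near=> n.
have nn0 : (n0 <= n)%N by near: n; exact: nbhs_infty_ge.
have : snr_threshold c C eps <= n%:R * (m n)%:R^-1 * norm2 (mu1 n - mu2 n) ^+ 2 by near: n.
have [[s s1n tauE] ctau] := htau _ nn0; have [k0 mu12] := hmu _ nn0.
set D := norm2 _ ^+ 2 => AD.
have D0 : 0 < D.
  rewrite /D /norm2 sqr_sqrtr; last by apply: sumr_ge0 => k _; exact: sqr_ge0.
  rewrite (bigD1 k0)//= ltr_pwDl//; last by apply: sumr_ge0 => k _; exact: sqr_ge0.
  by rewrite !mxE exprn_even_gt0//= subr_eq0.
have m0 : 0 < (m n)%:R :> R by rewrite ltr0n; exact: leq_ltn_trans (ltn_ord k0).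
have nD : snr_threshold c C eps * (m n)%:R <= n%:R * D.
  by move: AD; rewrite mulrAC -ler_pdivlMr ?invr_gt0// invrK.
have n0' : 0 < n%:R :> R.
  by rewrite ltr0n; case/andP: s1n => s1 sn; exact: leq_trans sn.
have [mD Cm le_eps] := bound_le_eps hc C0 eps0 D0 m0 n0' nD.
have -> : tau n = s%:R / n%:R by [].
apply: (le_trans (fixed_sample (C := C) (K := K) hc s1n _ (hseries _ nn0) _ _ _ _
  (hlse _ nn0) C1 _ D0 K0 mD Cm)).
- by rewrite -tauE.
- by rewrite -tauE; exact: hpre.
- by rewrite -tauE; exact: hpost.
- by rewrite -tauE; exact: hprepost.
- by rewrite -tauE; exact: hmean.
- by move=> k t ht; exact: hC.
by rewrite lee_fin.
Unshelve. all: by end_near.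
Qed.
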